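(* Consider a finite-horizon mean-field game (as described in the context) with linear rewards and mean-field independent dynamics: there are constants $\bar r_{s,a,t}\in\mathbb R$, $\bar P_{s',s,a,t}\in\mathbb R$ and vectors $\bar R_{s,a,t}\in\mathbb R^{SA}$ such that $$r_t(s,a,L_t)=\bar r_{s,a,t}+L_t^\top\bar R_{s,a,t},\qquad P_t(s'|s,a,L_t)=\bar P_{s',s,a,t}$$ for all $s,s'\in\mathcal S$, $a\in\mathcal A$, $t\in\mathcal T$ and $L_t\in\Delta(\mathcal S\times\mathcal A)$. Then a Nash equilibrium solution of the game can be found in finite time; that is, there is an algorithm which, given the data $\mu_0,\bar r,\bar R,\bar P$, terminates after finitely many steps and outputs a Nash equilibrium solution.
   Context: **Mean-field game.** $\mathcal S,\mathcal A$ are finite sets with $|\mathcal S|=S$, $|\mathcal A|=A$; $T$ is a finite time horizon and $\mathcal T=\{0,1,\dots,T\}$. For a finite set $X$, $\Delta(X)$ is the set of probability vectors on $X$. $\mu_0\in\Delta(\mathcal S)$ is the initial distribution. For $t\in\mathcal T$, $s\in\mathcal S$, $a\in\mathcal A$ and $\ell\in\Delta(\mathcal S\times\mathcal A)$ there are a transition probability $P_t(\cdot|s,a,\ell)\in\Delta(\mathcal S)$ and a reward $r_t(s,a,\ell)\in\mathbb R$. A policy (sequence) is $\pi=\{\pi_t\}_{t\in\mathcal T}$ with $\pi_t(\cdot|s)\in\Delta(\mathcal A)$; a mean-field flow is $L=\{L_t\}_{t\in\mathcal T}$ with $L_t\in\Delta(\mathcal S\times\mathcal A)$, where $L_t$ is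 viewed as a vector in $\mathbb R^{SA}$. For a flow $L$, $\mathcal M(L)$ is the MDP with initial law $s_0\sim\mu_0$, dynamics $s_{t+1}\sim P_t(\cdot|s_t,a_t,L_t)$ ($0\le t\le T-1$), controls $a_t\sim\pi_t(\cdot|s_t)$ ($t\in\mathcal T$) and objective to maximize $\mathbb E\big[\sum_{t=0}^T r_t(s_t,a_t,L_t)\big]$ over policies $\pi$. **Nash equilibrium solution.** $(\pi,L)$ is a Nash equilibrium solution if (1) $\pi$ is optimal for $\mathcal M(L)$; and (2) $L_0(s,a)=\mu_0(s)\pi_0(a|s)$ and $L_{t+1}(s',a')=\pi_{t+1}(a'|s')\sum_{s,a}L_t(s,a)P_t(s'|s,a,L_t)$ for $t=0,\dots,T-1$. **Model of computation.** A step is an exact arithmetic operation or comparison on real numbers; in particular a linear program is regarded as solvable to global optimality in finite time. *)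

(* Defs.v *)
From mathcomp Require Import all_boot all_order all_algebra.
From mathcomp Require Import reals.
Set Implicit Arguments.
Unset Strict Implicit.
Unset Printing Implicit Defensive.
Import Order.TTheory GRing.Theory Num.Theory.
Local Open Scope ring_scope.

(** * Probability vectors *)

Definition is_dist (R : realType) (X : finType) (p : {ffun X -> R}) : bool :=
  [forall x, 0 <= p x] && (\sum_x p x == 1).

Record dist (R : realType) (X : finType) := Dist {
  pmf :> {ffun X -> R};
  pmfP : is_dist pmf
}.

(** * Finite-horizon mean-field games *)

(* The time set {0, ..., T} is 'I_T.+1.                                       *)
Record mfg (R : realType) (S A : finType) (T : nat) := MFG {
  init : dist R S;
  trans : 'I_T.+1 -> S -> A -> dist R (S * A)%type -> dist R S;
  reward : 'I_T.+1 -> S -> A -> dist R (S * A)%type -> R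
}.

Definition policy (R : realType) (S A : finType) (T : nat) :=
  'I_T.+1 -> S -> dist R A.

Definition flow (R : realType) (S A : finType) (T : nat) :=
  'I_T.+1 -> dist R (S * A)%type.

(* For t : 'I_T, the times t and t + 1 of {0, ..., T}.                        *)
Definition now (T : nat) (t : 'I_T) : 'I_T.+1 := widen_ord (leqnSn T) t.
Definition next (T : nat) (t : 'I_T) : 'I_T.+1 := lift ord0 t.

Section Game.
Variables (R : realType) (S A : finType) (T : nat) (G : mfg R S A T).

Definition trajectory := {ffun 'I_T.+1 -> S * A}.

(* The law of (s_0, a_0, ..., s_T, a_T) in the MDP M(L) under the policy pi.  *)
Definition traj_prob (L : flow R S A T) (pi : policy R S A T)
    (w : trajectory) : R :=
  init G (w ord0).1 *
  (\prod_(t < T) trans G (now t) (w (now t)).1 (w (now t)).2 (L (now t))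
                   (w (next t)).1) *
  \prod_(t < T.+1) pi t (w t).1 (w t).2.

Definition expected_reward (L : flow R S A T) (pi : policy R S A T) : R :=
  \sum_(w : trajectory) traj_prob L pi w *
    \sum_(t < T.+1) reward G t (w t).1 (w t).2 (L t).

Definition optimal_policy (L : flow R S A T) (pi : policy R S A T) : Prop :=
  forall pi' : policy R S A T, expected_reward L pi' <= expected_reward L pi.

Definition consistent_flow (pi : policy R S A T) (L : flow R S A T) : Prop :=
  (forall s a, L ord0 (s, a) = init G s * pi ord0 s a) /\
  (forall (t : 'I_T) s' a',
     L (next t) (s', a') =
     pi (next t) s' a' *
       \sum_s \sum_a L (now t) (s, a) * trans G (now t) s a (L (now t)) s').

Definition nash_equilibrium (pi : policy R S A T) (L : flow R S A T) : Prop :=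
  optimal_policy L pi /\ consistent_flow pi L.

Definition linear_rewards (rbar : S -> A -> 'I_T.+1 -> R)
    (Rbar : S -> A -> 'I_T.+1 -> S * A -> R) : Prop :=
  forall t s a (l : dist R (S * A)%type),
    reward G t s a l = rbar s a t + \sum_x l x * Rbar s a t x.

Definition mean_field_independent
    (Pbar : S -> S -> A -> 'I_T.+1 -> R) : Prop :=
  forall t s' s a (l : dist R (S * A)%type),
    trans G t s a l s' = Pbar s' s a t.

End Game.

(** * Programs over the reals *)

(* A real RAM with structured control.  Integer registers serve for control   *)
(* and indexing; real arrays have any number of indices, and each cell holds  *)
(* an exact real.  The only real constants are 0 and 1, the only real         *)
(* operations are + - * / and comparison, and no operation turns a real into  *)
(* an integer.  A program is a finite piece of syntax that mentions neither   *)
(* the real numbers nor the size of its input.                                *)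

Inductive iexp :=
| IConst of nat
| IReg of nat
| IAdd of iexp & iexp
| ISub of iexp & iexp
| IMul of iexp & iexp
| IDiv of iexp & iexp
| IMod of iexp & iexp.

Inductive rexp :=
| RZero
| ROne
| RCell of nat & seq iexp
| RAdd of rexp & rexp
| RSub of rexp & rexp
| RMul of rexp & rexp
| RDiv of rexp & rexp.

Inductive bexp :=
| BIle of iexp & iexp
| BRle of rexp & rexp
| BNot of bexp
| BAnd of bexp & bexp.

Inductive prog :=
| Skip
| ISet of nat & iexp
| RSet of nat & seq iexp & rexp
| Seq of prog & prog
| If of bexp & prog & prog
| While of bexp & prog.

Record memory (R : realType) := Memory {
  ireg : nat -> nat;
  rarr : nat -> seq nat -> R
}.

Section Semantics.
Variable R : realType.
Implicit Types m : memory R.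

Fixpoint ieval m (e : iexp) : nat :=
  match e with
  | IConst n => n
  | IReg x => ireg m x
  | IAdd e1 e2 => (ieval m e1 + ieval m e2)%N
  | ISub e1 e2 => (ieval m e1 - ieval m e2)%N
  | IMul e1 e2 => (ieval m e1 * ieval m e2)%N
  | IDiv e1 e2 => (ieval m e1 %/ ieval m e2)%N
  | IMod e1 e2 => (ieval m e1 %% ieval m e2)%N
  end.

(* Division by 0 returns 0; this adds no power, as a program can test for 0.  *)
Fixpoint reval m (e : rexp) : R :=
  match e with
  | RZero => 0
  | ROne => 1
  | RCell x js => rarr m x (map (ieval m) js)
  | RAdd e1 e2 => reval m e1 + reval m e2
  | RSub e1 e2 => reval m e1 - reval m e2
  | RMul e1 e2 => reval m e1 * reval m e2
  | RDiv e1 e2 => reval m e1 / reval m e2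
  end.

Fixpoint beval m (b : bexp) : bool :=
  match b with
  | BIle e1 e2 => (ieval m e1 <= ieval m e2)%N
  | BRle e1 e2 => reval m e1 <= reval m e2
  | BNot b1 => ~~ beval m b1
  | BAnd b1 b2 => beval m b1 && beval m b2
  end.

Definition iupdate m (x n : nat) : memory R :=
  Memory (fun y => if y == x then n else ireg m y) (rarr m).

Definition rupdate m (x : nat) (js : seq nat) (v : R) : memory R :=
  Memory (ireg m)
    (fun y ks => if (y == x) && (ks == js) then v else rarr m y ks).

(* A configuration is the list of programs still to be executed, together     *)
(* with the memory.  A step performs the (boundedly many, by the program      *)
(* text) arithmetic operations and comparisons of a single command.           *)
Definition config := (seq prog * memory R)%type.

Definition step (c : config) : config :=
  let: (k, m) := c in
  match k with
  | [::] => ([::], m)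
  | Skip :: k' => (k', m)
  | ISet x e :: k' => (k', iupdate m x (ieval m e))
  | RSet x js e :: k' =>
      (k', rupdate m x (map (ieval m) js) (reval m e))
  | Seq p q :: k' => (p :: q :: k', m)
  | If b p q :: k' => ((if beval m b then p else q) :: k', m)
  | While b p :: k' => (if beval m b then p :: While b p :: k' else k', m)
  end.

Definition terminates_with (p : prog) m m' : Prop :=
  exists n : nat, iter n step ([:: p], m) = ([::], m').

End Semantics.

(** * Input and output conventions *)

(* Elements of a finite type are indexed by their rank in its enumeration.    *)
Definition rk (X : finType) (x : X) : nat := enum_rank x.

(* The memory is unconstrained apart from the cells listed here, so that a    *)
(* program may not rely on the initial contents of its work space.            *)
Definition holds_input (R : realType) (S A : finType) (T : nat)
    (mu0 : dist R S)
    (rbar : S -> A -> 'I_T.+1 -> R)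
    (Rbar : S -> A -> 'I_T.+1 -> S * A -> R)
    (Pbar : S -> S -> A -> 'I_T.+1 -> R)
    (m : memory R) : Prop :=
  [/\ [/\ ireg m 0 = #|S|, ireg m 1 = #|A| & ireg m 2 = T],
      forall s, rarr m 0 [:: rk s] = mu0 s,
      forall s a t, rarr m 1 [:: rk s; rk a; val t] = rbar s a t,
      forall s a t s' a',
        rarr m 2 [:: rk s; rk a; val t; rk s'; rk a'] = Rbar s a t (s', a')
    & forall s' s a t, rarr m 3 [:: rk s'; rk s; rk a; val t] = Pbar s' s a t].

Definition holds_output (R : realType) (S A : finType) (T : nat)
    (pi : policy R S A T) (L : flow R S A T) (m : memory R) : Prop :=
  (forall t s a, rarr m 4 [:: val t; rk s; rk a] = pi t s a) /\
  (forall t s a, rarr m 5 [:: val t; rk s; rk a] = L t (s, a)).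

(* Main.v *)
From HB Require Import structures.
Require Import Defs.
From mathcomp Require Import all_boot all_order all_algebra.
From mathcomp Require Import boolp reals ring.

(** An equilibrium is found by exhaustive search over straight-line programs.

    Existence.  The dynamics ignore the mean field, so the flow of a policy is its
    occupation measure, and the rewards are linear, so the payoff of one occupation
    measure against another is bilinear up to a term that involves only the first.
    Mixtures of deterministic policies produce flows of behaviour policies
    ([mixture_flow]).  Hence it is enough to find a symmetric equilibrium of the
    finite symmetric game whose pure strategies are the deterministic policies.

    Symmetric equilibria of finite games correspond to nonzero solutions of a linear
    complementarity problem [B x + s = 1], [x, s >= 0], [x_i s_i = 0] with a positive
    matrix [B].  They exist by the Lemke-Howson parity argument: after a generic
    perturbation of the right-hand side, any set of columns with one element more
    than a basis contains an even number of feasible bases ([even_feasible]); double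
    counting then shows that the number of complementary feasible bases is even
    ([odd_branches]), and the trivial one, all slacks, is one of them.  Unlike a
    topological proof, this exhibits the equilibrium as the solution of a square
    linear system, so its weights lie in the field generated by the payoffs
    ([complementary_solution]).  Together with the optimal value function of the
    flow, the equilibrium forms a certificate: a policy, its flow, and a solution of
    the Bellman inequalities that is tight where the flow is positive.  So some
    certificate has all its entries in the field generated by the data
    ([certificate_exists]).  Conversely every certificate proves that its policy and
    flow are an equilibrium ([certificate_sound]).

    Search.  Each element of the field generated by the data is the result of a
    straight-line program over the input cells with the operations 1, subtraction
    and division ([computables_divring]), so some straight-line program writes a
    whole certificate into the memory ([performs_stores]).  The program runs through
    the natural numbers, decodes each as a straight-line program by reading its
    digits, executes it, and checks by bounded loops whether the arrays now hold a
    certificate ([holds_nash]).  It stops ([search_terminates]), and it stops at an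
    equilibrium. *)

Set Implicit Arguments.
Unset Strict Implicit.
Unset Printing Implicit Defensive.
Import Order.TTheory GRing.Theory Num.Theory.
Local Open Scope ring_scope.

(** * Parity of complementary bases *)

Lemma big_pair (V : Type) (idx : V) (op : Monoid.com_law idx) (I J : finType)
    (F : I * J -> V) :
  \big[op/idx]_x F x = \big[op/idx]_i \big[op/idx]_j F (i, j).
Proof. by rewrite pair_bigA; apply: eq_bigr => -[]. Qed.

Section Parity.
Variables (n : nat) (i0 : 'I_n).
Implicit Types (b : {ffun 'I_n -> bool}) (i : 'I_n).

Definition branch b : {set 'I_n * bool} := [set j | j.2 == b j.1].

(** The edges of the Lemke-Howson path with missing label [i0]: sets with one
    column more than a basis. *)
Definition doubled b : {set 'I_n * bool} :=
  [set j | (j.2 == b j.1) || (j.1 == i0)].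
Definition flip i b : {ffun 'I_n -> bool} := [ffun k => b k (+) (k == i)].

Lemma flipK i : involutive (flip i).
Proof. by move=> b; apply/ffunP=> k; rewrite !ffunE -addbA addbb addbF. Qed.

Lemma card_branch b : #|branch b| = n.
Proof.
have -> : branch b = [set (i, b i) | i : 'I_n].
  apply/setP=> -[i c]; rewrite inE /=; apply/eqP/imsetP => [->|[k _ [-> ->]] //].
  by exists i.
by rewrite card_imset ?card_ord // => i k [].
Qed.

Lemma doubledE b : doubled b = (i0, ~~ b i0) |: branch b.
Proof.
apply/setP=> -[i c]; rewrite !inE /= xpair_eqE.
by case: (i =P i0) => [->|_]; [case: c; case: (b i0)|rewrite orbF].
Qed.

Lemma card_doubled b : #|doubled b| = n.+1.
Proof.
by rewrite doubledE cardsU1 card_branch inE /=; case: (b i0).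
Qed.

Lemma odd_sum_flip i (g : {ffun 'I_n -> bool} -> nat) :
    i != i0 -> (forall b, g (flip i b) = g b) ->
  odd (\sum_(b : {ffun 'I_n -> bool} | b i0) g b) = false.
Proof.
move=> neq_i gE; rewrite (bigID (fun b => b i)) /=.
rewrite (reindex_inj (inv_inj (flipK i))) /=.
rewrite [X in (X + _)%N](_ : _ = \sum_(b : {ffun 'I_n -> bool} | b i0 && ~~ b i) g b)%N.
  by rewrite addnn odd_double.
apply: eq_big => [b|b _]; last exact: gE.
by rewrite !ffunE eqxx [i0 == i]eq_sym (negPf neq_i) addbF addbT.
Qed.

(** The handshake argument behind the Lemke-Howson path, without the path.
    Count the pairs of a set [doubled b] and an element whose removal leaves a
    member of [F]; by hypothesis every [doubled b] takes part in an even number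
    of them.  Removing an element of the pair at [i0] leaves a [branch], and each
    branch is obtained exactly once.  Removing an element of another pair leaves
    a set that arises from two sets [doubled b], which differ at that pair.  So
    modulo 2 only the branches remain. *)
Lemma odd_branches (F : pred {set 'I_n * bool}) :
    (forall D : {set 'I_n * bool}, #|D| = n.+1 ->
       odd #|[set k in D | F (D :\ k)]| = false) ->
  odd (\sum_(b : {ffun 'I_n -> bool}) F (branch b)) = false.
Proof.
move=> evenF.
pose cnt b (j : 'I_n * bool) : nat := (j \in doubled b) && F (doubled b :\ j).
(* [doubled b] does not depend on [b i0]; fixing [b i0] counts each set once. *)
have: odd (\sum_(b : {ffun 'I_n -> bool} | b i0) \sum_j cnt b j) = false.
  elim/big_rec: _ => //= b m _ IH; rewrite oddD IH addbF.
  rewrite -(evenF (doubled b)) ?card_doubled //; congr odd.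
  rewrite -sum1_card [RHS]big_mkcond /=; apply: eq_bigr => j _.
  by rewrite !inE /cnt inE; case: ifP.
have splitE b :
    (\sum_j cnt b j = \sum_c cnt b (i0, c) + \sum_(i | i != i0) \sum_c cnt b (i, c))%N.
  by rewrite big_pair (bigD1 i0).
rewrite (eq_bigr _ (fun b _ => splitE b)).
rewrite big_split oddD [X in _ (+) odd X]exchange_big /= [X in _ (+) X](_ : _ = false) ?addbF.
  move<-; congr odd; rewrite (bigID (fun b => b i0)) /=.
  rewrite [X in (_ + X)%N](reindex_inj (inv_inj (flipK i0))) /=.
  rewrite [X in (_ + X)%N](eq_bigl (fun b => b i0)); last first.
    by move=> b; rewrite !ffunE eqxx addbT negbK.
  rewrite -big_split /=; apply: eq_bigr => b bi0; rewrite big_bool /cnt !inE /= eqxx !orbT /=.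
  rewrite addnC; congr (nat_of_bool (F _) + nat_of_bool (F _))%N; apply/setP=> -[i c].
    rewrite !inE !ffunE xpair_eqE /=; case: (i =P i0) => [->|_] /=.
      by rewrite bi0; case: c.
    by rewrite addbF orbF.
  rewrite !inE xpair_eqE /=; case: (i =P i0) => [->|_] /=.
    by rewrite bi0; case: c.
  by rewrite orbF.
elim/big_rec: _ => //= i m neq_i IH; rewrite oddD IH addbF.
have cntE b : (\sum_c cnt b (i, c))%N = F (doubled b :\ (i, b i)).
  rewrite big_bool /cnt !inE /= (negPf neq_i) !orbF.
  by case: (b i); rewrite ?addn0 ?add0n.
apply: (odd_sum_flip neq_i) => b; rewrite !cntE; congr (nat_of_bool (F _)).
apply/setP=> -[k c]; rewrite !inE !ffunE !xpair_eqE eqxx addbT /=.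
case: (k =P i) => [->|_] /=; last by rewrite addbF.
by rewrite (negPf neq_i) !orbF addbT; case: (b i) c => -[].
Qed.
End Parity.

(** * Bases of a nondegenerate polytope *)

Lemma kernel_row (F : fieldType) m n (M : 'M[F]_(m, n)) :
  (n < m)%N -> exists2 u : 'rV_m, u != 0 & u *m M = 0.
Proof.
move=> lt_nm; have : kermx M != 0.
  rewrite -mxrank_eq0 mxrank_ker subn_eq0 -ltnNge.
  exact: leq_ltn_trans (rank_leq_col M) lt_nm.
by case/rowV0Pn=> u /sub_kermxP uM u0; exists u.
Qed.

Lemma card_del (T : finType) (D : {set T}) j m :
  j \in D -> #|D| = m -> (#|D :\ j| < m)%N.
Proof. by move=> jD <-; rewrite (cardsD1 j D) jD. Qed.

(** The polytope is the set of [y >= 0] with [B x + s = q], where [y (k, true)]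
    is the variable [x_k] and [y (k, false)] the slack [s_k]; the index [k] of
    the pair is what complementarity is about.  A set [D] of [n] indices stands
    for the basis with these columns. *)
Section Polytope.
Variables (R : realFieldType) (n : nat) (B : 'M[R]_n).
Implicit Types (y z : 'I_n * bool -> R) (q : 'I_n -> R).
Implicit Types (D : {set 'I_n * bool}) (j : 'I_n * bool).

Definition lhs y i : R := \sum_k B i k * y (k, true) + y (i, false).
Definition solves q y := forall i, lhs y i = q i.
Definition supported D y := forall j, j \notin D -> y j = 0.

(** Solutions of any sign are excluded, so that a set of [n] columns that carries
    a solution is automatically linearly independent ([supp_kernel0]). *)
Definition nondegenerate q :=
  forall D y, (#|D| < n)%N -> solves q y -> ~ supported D y.
Definition feasible q D :=
  exists y, [/\ forall j, 0 <= y j, supported D y & solves q y].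

Lemma lhs_line y z c i :
  lhs (fun j => y j + c * z j) i = lhs y i + c * lhs z i.
Proof.
rewrite /lhs mulrDr mulr_sumr addrACA -big_split; congr (_ + _).
by apply: eq_bigr => k _; rewrite mulrDr mulrCA.
Qed.

Definition column j i : R := if j.2 then B i j.1 else (j.1 == i)%:R.

Lemma lhsE y i : lhs y i = \sum_j column j i * y j.
Proof.
rewrite big_pair; under [RHS]eq_bigr do rewrite big_bool; rewrite big_split /=; congr (_ + _).
rewrite (bigD1 i) //= /column eqxx mul1r big1 ?addr0 // => k /negPf.
by rewrite /= => ->; rewrite mul0r.
Qed.

Lemma kernel_supported D : (n < #|D|)%N ->
  exists z, [/\ exists j, z j != 0, supported D z & forall i, lhs z i = 0].
Proof.
move=> gtD.
pose M : 'M[R]_(#|D|, n) := \matrix_(k, i) column (enum_val k) i.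
have [u u0 uM] := kernel_row M gtD.
pose z j : R := \sum_(k | enum_val k == j) u 0 k.
exists z; split => [|j jD|i].
- have /rV0Pn[k uk] := u0; exists (enum_val k).
  by rewrite /z (big_pred1 k) // => l /=; rewrite (inj_eq enum_val_inj).
- rewrite /z big1 // => k /eqP jE.
  by rewrite -jE enum_valP in jD.
transitivity ((u *m M) 0 i); last by rewrite uM mxE.
rewrite lhsE mxE (partition_big enum_val xpredT) //=; apply: eq_bigr => j _.
by rewrite mulr_sumr; apply: eq_bigr => k /eqP <-; rewrite mxE mulrC.
Qed.

Lemma supported_line D y z c :
  supported D y -> supported D z -> supported D (fun j => y j + c * z j).
Proof. by move=> sy sz j jD; rewrite sy ?sz // mulr0 addr0. Qed.

Lemma supportedD1 D y k : supported D y -> y k = 0 -> supported (D :\ k) y.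
Proof.
by move=> sy yk j; rewrite !inE negb_and negbK => /orP[/eqP->|/sy].
Qed.

Lemma solves_line q y z c :
    solves q y -> (forall i, lhs z i = 0) ->
  solves q (fun j => y j + c * z j).
Proof. by move=> qy z0 i; rewrite lhs_line z0 mulr0 addr0 qy. Qed.

(** Moving from a solution along a kernel vector until a coordinate vanishes
    would give a solution on fewer than [n] columns. *)
Lemma supp_kernel0 q D y z :
    nondegenerate q -> #|D| = n -> solves q y -> supported D y ->
    supported D z -> (forall i, lhs z i = 0) ->
  forall j, z j = 0.
Proof.
move=> ndq cD qy sy sz z0 j; apply/eqP; apply/negPn/negP=> zj.
have jD : j \in D by apply: contraR zj => /sz->.
pose y' k := y k + (- (y j / z j)) * z k.
apply: (ndq (D :\ j) y').
- exact: card_del cD.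
- exact: solves_line.
by apply: supportedD1; [exact: supported_line|rewrite /y' mulNr divfK ?subrr].
Qed.

Lemma supp_full q D y :
    nondegenerate q -> #|D| = n -> solves q y -> supported D y ->
  forall j, j \in D -> y j != 0.
Proof.
move=> ndq cD qy sy j jD; apply/eqP=> yj0.
apply: (ndq (D :\ j) y) => //; last exact: supportedD1.
exact: card_del cD.
Qed.

Hypothesis B_gt0 : forall i l : 'I_n, 0 < B i l.

(** Boundedness of the polytope: as [B] is positive, it has no unbounded ray. *)
Lemma kernel_ge0 z :
  (forall i, lhs z i = 0) -> (forall j, 0 <= z j) -> forall j, z j = 0.
Proof.
move=> z0 z_ge0.
have term_ge0 i k : 0 <= B i k * z (k, true) by rewrite mulr_ge0 // ltW.
have zt (i k : 'I_n) : z (k, true) = 0.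
  have := z0 i; rewrite /lhs => /eqP; rewrite paddr_eq0 ?sumr_ge0 //.
  case/andP=> /eqP sum0 _.
  have /eqP := psumr_eq0P (fun l _ => term_ge0 i l) sum0 (i:=k) isT.
  by rewrite mulf_eq0 gt_eqF // => /eqP.
case=> [k []]; first exact: (zt k k).
have := z0 k; rewrite /lhs big1 ?add0r // => l _.
by rewrite (zt k l) mulr0.
Qed.

Lemma kernel_neg z :
  (exists j, z j != 0) -> (forall i, lhs z i = 0) -> exists j, z j < 0.
Proof.
move=> [j zj] z0; apply: contrapT => noneg; case/eqP: zj.
apply: (kernel_ge0 z0) => k; rewrite leNgt; apply/negP=> zk.
by apply: noneg; exists k.
Qed.

Lemma lhs_scale z c i : lhs (fun j => c * z j) i = c * lhs z i.
Proof.
by rewrite /lhs mulrDr mulr_sumr; congr (_ + _); apply: eq_bigr => k _; rewrite mulrCA.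
Qed.

(** The pivoting step.  The solutions carried by the [n + 1] columns of [D] form a
    line; the nonnegative ones form a segment, bounded by [kernel_neg], whose
    endpoints are the feasible bases inside [D].  Nondegeneracy lets only one
    coordinate vanish at each endpoint, so there are two such bases, or none. *)
Lemma even_feasible q D : nondegenerate q -> #|D| = n.+1 ->
  odd #|[set k in D | `[< feasible q (D :\ k) >]]| = false.
Proof.
move=> ndq cD; have [->|[k0]] := set_0Vmem [set k in D | `[< feasible q (D :\ k) >]].
  by rewrite cards0.
rewrite inE => /andP[k0D /asboolP[y [y_ge0 sy qy]]].
have cDk k : k \in D -> #|D :\ k| = n.
  by move=> kD; move: cD; rewrite (cardsD1 k) kD => -[].
have subD k x : supported (D :\ k) x -> supported D x.
  by move=> sx j jD; rewrite sx // inE (negPf jD) andbF.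
have k0_kernel w : supported D w -> (forall i, lhs w i = 0) -> w k0 = 0 ->
    forall j, w j = 0.
  move=> sw w0 wk0.
  apply: (supp_kernel0 ndq (cDk _ k0D) qy sy _ w0).
  exact: supportedD1.
have [z [zk0 sz z0]] : exists z, [/\ z k0 = 1, supported D z & forall i, lhs z i = 0].
  have [|z [[j zj] sz z0]] := @kernel_supported D; first by rewrite cD.
  have zk0 : z k0 != 0 by apply: contra zj => /eqP/(k0_kernel _ sz z0)->.
  exists (fun j => (z k0)^-1 * z j); split => [|k kD|i]; first by rewrite mulVf.
    by rewrite (sz k) ?mulr0.
  by rewrite lhs_scale z0 mulr0.
have yk0 : y k0 = 0 by rewrite sy // !inE eqxx.
have uniq_y x : supported D x -> solves q x -> forall j, x j = y j + x k0 * z j.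
  move=> sx qx j; apply/eqP; rewrite -subr_eq0 opprD addrA; apply/eqP.
  pose w k := (x k + (- 1) * y k) + (- x k0) * z k.
  suff : w j = 0 by rewrite /w mulN1r mulNr.
  apply: k0_kernel => [|i|]; last by rewrite /w yk0 zk0 mulr0 mulr1 addr0 subrr.
    by apply: supported_line => //; apply: supported_line => //; apply: subD sy.
  by rewrite !lhs_line z0 qx qy mulr0 mulN1r subrr addr0.
have [|k' zk'] := kernel_neg _ z0; first by exists k0; rewrite zk0 oner_neq0.
(* Minimum ratio test: [k1] is the first coordinate to vanish from [y] along [z]. *)
case: (@arg_minP _ _ _ k' (fun k => z k < 0) (fun k => y k / - z k) zk') => k1 zk1 k1min.
have neg_D k : z k < 0 -> k \in D.
  by apply: contraTT => /sz->; rewrite ltxx.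
have neq_k10 : k1 != k0.
  by apply: contraTneq zk1 => ->; rewrite zk0 ltNge ler01.
have yk1 : 0 < y k1.
  by rewrite lt0r y_ge0 (supp_full ndq (cDk _ k0D) qy sy) // !inE neq_k10 neg_D.
pose c := y k1 / - z k1.
have c_gt0 : 0 < c by rewrite divr_gt0 ?oppr_gt0.
pose y1 j := y j + c * z j.
have y1k1 : y1 k1 = 0.
  by rewrite /y1 /c invrN mulrN mulNr divfK ?subrr // lt_eqF.
have sy1 : supported D y1 by apply: supported_line => //; apply: subD sy.
have qy1 : solves q y1 by apply: solves_line.
have y1_ge0 j : 0 <= y1 j.
  have [zj|zj] := leP 0 (z j); first exact: addr_ge0 (y_ge0 j) (mulr_ge0 (ltW c_gt0) zj).
  have := k1min j zj; rewrite -/c ler_pdivlMr ?oppr_gt0 // mulrN => h.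
  by rewrite /y1 -[c * _]opprK subr_ge0.
suff -> : [set k in D | `[< feasible q (D :\ k) >]] = [set k1; k0].
  by rewrite cards2 neq_k10.
apply/setP=> k; rewrite !inE; apply/andP/orP => [[kD /asboolP[x [x_ge0 sx qx]]]|].
  have xE := uniq_y _ (subD _ _ sx) qx.
  have xk : x k = 0 by rewrite sx // !inE eqxx.
  have := x_ge0 k0; rewrite le0r => /predU1P[xk0|xk0_gt0].
    right; apply: contraT => neq_k.
    have := supp_full ndq (cDk _ k0D) qy sy (j := k).
    rewrite !inE neq_k kD => /(_ isT); rewrite -xk xE xk0 mul0r addr0 eqxx //.
  left; apply: contraT => neq_k.
  have zk : z k < 0.
    rewrite ltNge; apply/negP=> zk_ge0.
    have : y k + x k0 * z k = 0 by rewrite -xE.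
    move/eqP; rewrite paddr_eq0 // ?mulr_ge0 // => /andP[yk].
    rewrite mulf_eq0 gt_eqF //= => zk.
    have [kk0|kk0] := eqVneq k k0; first by rewrite kk0 zk0 oner_eq0 in zk.
    have := supp_full ndq (cDk _ k0D) qy sy (j := k).
    by rewrite !inE kk0 kD yk => /(_ isT).
  have le_c : c <= x k0.
    apply: le_trans (k1min k zk) _; rewrite ler_pdivrMr ?oppr_gt0 //.
    by rewrite mulrN -subr_ge0 -opprD addrC -xE xk oppr0.
  have ge_c : x k0 <= c.
    rewrite ler_pdivlMr ?oppr_gt0 // mulrN -subr_ge0 opprK -xE; exact: x_ge0.
  have xc : x k0 = c by apply: le_anti; rewrite ge_c.
  have y1k : y1 k = 0 by rewrite /y1 -xc -xE.
  have := supp_full ndq (cDk _ (neg_D _ zk1)) qy1 (supportedD1 sy1 y1k1) (j := k).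
  by rewrite !inE neq_k kD y1k eqxx => /(_ isT).
case=> /eqP->; split=> //; rewrite ?neg_D //; apply/asboolP.
  by exists y1; split => //; apply: supportedD1.
by exists y.
Qed.
End Polytope.

(** * Generic perturbation and complementary solutions *)

Section Near0.
Variable R : realFieldType.
Implicit Types (P Q : R -> Prop) (p : {poly R}).

Definition near0 P := exists2 e, 0 < e & forall x, 0 < x < e -> P x.

Lemma near0W P Q : (forall x, P x -> Q x) -> near0 P -> near0 Q.
Proof. by move=> PQ [e e0 Pe]; exists e => // x /Pe/PQ. Qed.

Lemma near0_all (T : finType) (P : T -> R -> Prop) :
  (forall t, near0 (P t)) -> near0 (fun x => forall t, P t x).
Proof.
move=> nearP.
suff: forall s : seq T, near0 (fun x => forall t, t \in s -> P t x).
  by move=> /(_ (enum T)); apply: near0W => x Px t; apply: Px; rewrite mem_enum.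
elim=> [|t s [e e0 Pe]]; first by exists 1.
have [d d0 Pd] := nearP t; exists (Num.min d e); first by rewrite lt_min d0.
move=> x /andP[x0]; rewrite lt_min => /andP[xd xe] u.
by rewrite inE => /predU1P[->|]; [apply: Pd|apply: Pe]; rewrite x0.
Qed.

Lemma near0_and P Q : near0 P -> near0 Q -> near0 (fun x => P x /\ Q x).
Proof.
move=> nP nQ.
have /near0W : near0 (fun x => forall b : bool, if b then P x else Q x).
  by apply: near0_all => -[].
by apply=> x PQ; split; [apply: (PQ true)|apply: (PQ false)].
Qed.

Lemma poly_bounded p : exists M, forall x, 0 < x < 1 -> `|p.[x]| <= M.
Proof.
elim/poly_ind: p => [|p c [M pM]]; first by exists 0 => x; rewrite horner0 normr0.
exists (M + `|c|) => x x01; rewrite !hornerE.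
apply: le_trans (ler_normD _ _) _; rewrite lerD2r normrM.
have /andP[x0 x1] := x01.
by apply: le_trans (pM x x01); rewrite ler_piMr // gtr0_norm // ltW.
Qed.

Lemma near0_horner_gt0 p : 0 < p.[0] -> near0 (fun x => 0 < p.[x]).
Proof.
elim/poly_ind: p => [|p c _]; first by rewrite horner0 ltxx.
rewrite !hornerE => c0; have [M pM] := poly_bounded p.
have M1 : 0 < `|M| + 1 by rewrite ltr_wpDl.
exists (Num.min 1 (c / (`|M| + 1))); first by rewrite lt_min ltr01 divr_gt0.
move=> x /andP[x0]; rewrite lt_min ltr_pdivlMr // => /andP[x1 xc].
rewrite !hornerE -[p.[x] * x]opprK addrC subr_gt0; apply: le_lt_trans xc.
apply: le_trans (ler_norm _) _; rewrite normrN normrM (gtr0_norm x0) mulrC.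
apply: ler_wpM2l; [exact: ltW|apply: le_trans (pM x _) _]; first by rewrite x0.
by rewrite (le_trans (ler_norm M)) // lerDl.
Qed.

Lemma near0_horner_neq0 p : p != 0 -> near0 (fun x => p.[x] != 0).
Proof.
elim/poly_ind: p => [|p c IH]; first by rewrite eqxx.
have [->|c0 _] := eqVneq c 0.
  rewrite addr0 mulf_eq0 polyX_eq0 orbF => /IH[e e0 He]; exists e => // x xe.
  by have /andP[x0 _] := xe; rewrite hornerMX mulf_neq0 ?He // gt_eqF.
have [c_lt0|c_gt0|/eqP] := ltgtP c 0; last by rewrite (negPf c0).
  have := @near0_horner_gt0 (- (p * 'X + c%:P)).
  rewrite !hornerE oppr_gt0 => /(_ c_lt0); apply: near0W => x.
  by rewrite hornerN oppr_gt0 => /lt_eqF->.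
have := @near0_horner_gt0 (p * 'X + c%:P).
by rewrite !hornerE => /(_ c_gt0); apply: near0W => x /gt_eqF->.
Qed.
End Near0.

Section Closed.
Variables (F : fieldType) (K : divringClosed F).

Lemma rpred_det n (M : 'M[F]_n) : (forall i j, M i j \in K) -> \det M \in K.
Proof.
by move=> MK; apply: rpred_sum => s _; rewrite rpredMsign rpred_prod.
Qed.

Lemma rpred_invmx n (M : 'M[F]_n) :
  (forall i j, M i j \in K) -> forall i j, invmx M i j \in K.
Proof.
move=> MK i j; rewrite /invmx; case: ifP => // _; rewrite !mxE.
rewrite rpredM ?rpredV ?rpred_det // rpredMsign rpred_det // => k l.
by rewrite !mxE.
Qed.
End Closed.

Section SymmetricEquilibrium.
Variables (R : realFieldType) (n : nat) (B : 'M[R]_n).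
Hypothesis B_gt0 : forall i l : 'I_n, 0 < B i l.

(** The perturbed right-hand side lies on the moment curve through the vector of
    ones.  A nonzero linear form is a nonzero polynomial on this curve, so small
    perturbations avoid any given finite set of hyperplanes. *)
Definition moment (e : R) (i : 'I_n) : R := 1 + e ^+ i.+1.

Lemma moment_poly (u : 'I_n -> R) e :
  \sum_i u i * moment e i = (\sum_i u i *: (1 + 'X^(i.+1))).[e].
Proof. by rewrite horner_sum; apply: eq_bigr => i _; rewrite !hornerE. Qed.

(** Fewer than [n] columns lie in a hyperplane, and a right-hand side outside of
    it has no solution on these columns; there are finitely many sets of
    columns. *)
Lemma near0_nondegenerate : near0 (fun e => nondegenerate B (moment e)).
Proof.
suff: near0 (fun e => forall D : {set 'I_n * bool}, forall y,
    (#|D| < n)%N -> solves B (moment e) y -> ~ supported D y) by [].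
apply: near0_all => D; have [ltD|geD] := ltnP #|D| n; last by exists 1.
pose M : 'M[R]_(n, #|D|) := \matrix_(i, k) column B (enum_val k) i.
have [u /rV0Pn[i0 ui0] uM] := kernel_row M ltD.
pose p : {poly R} := \sum_i u 0 i *: (1 + 'X^(i.+1)).
have p0 : p != 0.
  apply: contraNneq ui0 => /(congr1 (fun p : {poly R} => p`_i0.+1)).
  rewrite coef0 coef_sum (bigD1 i0) //= coefZ coefD coef1 coefXn eqxx add0r mulr1.
  rewrite big1 ?addr0 => [->//|i neq_i].
  by rewrite coefZ coefD coef1 coefXn eqSS add0r eq_sym (negPf neq_i : (i == i0 :> nat) = _) mulr0.
apply: near0W (near0_horner_neq0 p0) => e pe y _ qy sy; case/eqP: pe.
rewrite -moment_poly; under eq_bigr do rewrite -qy lhsE mulr_sumr.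
rewrite exchange_big /= big1 // => j _.
have [jD|/sy->] := boolP (j \in D); last by rewrite big1 // => i _; rewrite !mulr0.
under eq_bigr do rewrite mulrA; rewrite -mulr_suml.
have := congr1 (fun v : 'rV_#|D| => v 0 (enum_rank_in jD j)) uM.
rewrite !mxE => uMj; rewrite [X in X * _](_ : _ = 0) ?mul0r // -[RHS]uMj.
by apply: eq_bigr => i _; rewrite mxE enum_rankK_in.
Qed.

Implicit Type b : {ffun 'I_n -> bool}.
Definition branch_mx b : 'M[R]_n := \matrix_(i, k) column B (k, b k) i.
Definition on_branch b (v : 'I_n -> R) (j : 'I_n * bool) : R :=
  if j.2 == b j.1 then v j.1 else 0.

Lemma on_branch_supported b v : supported (branch b) (on_branch b v).
Proof. by move=> j; rewrite inE /on_branch => /negPf->. Qed.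

Lemma lhs_on_branch b v i :
  lhs B (on_branch b v) i = \sum_k branch_mx b i k * v k.
Proof.
rewrite lhsE big_pair; apply: eq_bigr => k _; rewrite (bigD1 (b k)) //= /on_branch eqxx mxE big1 ?addr0 //.
by move=> c /negPf /= ->; rewrite mulr0.
Qed.

Lemma supported_branch b y :
  supported (branch b) y -> y =1 on_branch b (fun k => y (k, b k)).
Proof.
move=> sy [k c]; rewrite /on_branch /=; case: eqP => [->|/eqP neq] //.
by rewrite sy // inE.
Qed.

Lemma eq_lhs y z i : y =1 z -> lhs B y i = lhs B z i.
Proof. by move=> yz; rewrite !lhsE; apply: eq_bigr => j _; rewrite yz. Qed.

Lemma branch_mx_unit e b :
    nondegenerate B (moment e) -> feasible B (moment e) (branch b) ->
  branch_mx b \in unitmx.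
Proof.
move=> nd [y [_ sy qy]]; rewrite -unitmx_tr -row_free_unit -kermx_eq0.
apply: contraT => /rowV0Pn[u /sub_kermxP uM] /rV0Pn[k uk].
have lhs0 i : lhs B (on_branch b (u 0)) i = 0.
  have := congr1 (fun v : 'rV_n => v 0 i) uM; rewrite !mxE => <-.
  by rewrite lhs_on_branch; apply: eq_bigr => l _; rewrite !mxE mulrC.
have := supp_kernel0 nd (card_branch b) qy sy (@on_branch_supported b (u 0)) lhs0.
by move=> /(_ (k, b k)); rewrite /on_branch eqxx => /eqP; rewrite (negPf uk).
Qed.

(** The basic solution of a branch is a polynomial in the perturbation, so it
    cannot be nonnegative for small perturbations and have a negative coordinate
    without perturbation. *)
Lemma near0_solution b :
  near0 (fun e => branch_mx b \in unitmx -> feasible B (moment e) (branch b) ->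
    forall k, 0 <= \sum_i invmx (branch_mx b) k i).
Proof.
have [bU|/negPf bU] := boolP (branch_mx b \in unitmx); last by exists 1.
suff: near0 (fun e => forall k, feasible B (moment e) (branch b) ->
    0 <= \sum_i invmx (branch_mx b) k i).
  by apply: near0W => e He _ fe k; apply: He.
apply: near0_all => k; have [_|neg] := leP 0 (\sum_i invmx (branch_mx b) k i).
  by exists 1.
pose p : {poly R} := \sum_i invmx (branch_mx b) k i *: (1 + 'X^(i.+1)).
have : 0 < (- p).[0].
  rewrite hornerN -moment_poly oppr_gt0 /moment; under eq_bigr do rewrite expr0n addr0 mulr1.
  by [].
move/near0_horner_gt0; apply: near0W => e; rewrite hornerN oppr_gt0 => pe.
move=> [y [y_ge0 sy qy]]; move: pe; rewrite ltNge => /negP[].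
suff -> : p.[e] = y (k, b k) by [].
rewrite -moment_poly.
transitivity ((invmx (branch_mx b) *m (branch_mx b *m \col_l y (l, b l))) k 0).
  rewrite mxE; apply: eq_bigr => i _; congr (_ * _).
  rewrite -qy (eq_lhs _ (supported_branch sy)) lhs_on_branch mxE.
  by apply: eq_bigr => l _; congr (_ * _); rewrite mxE.
by rewrite mulKmx // mxE.
Qed.

(** For a small perturbation the number of feasible branches is even, and the
    branch of all slacks is one of them.  Another feasible branch stays feasible
    when the perturbation is removed, and its basic solution consists of row sums
    of the inverse of [branch_mx b], which lie in the field of the entries. *)
Lemma complementary_solution (K : divringClosed R) :
    (0 < n)%N -> (forall i k, B i k \in K) ->
  exists x : 'I_n -> R, [/\ forall k, 0 <= x k /\ x k \in K,
    forall i, \sum_k B i k * x k <= 1,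
    forall i, x i != 0 -> \sum_k B i k * x k = 1 & exists k, x k != 0].
Proof.
move=> n_gt0 BK.
have [e0 e0_gt0 near_e] := near0_and near0_nondegenerate (near0_all near0_solution).
have [|nd sol] := near_e (e0 / 2%:R).
  by rewrite divr_gt0 ?ltr0n //= ltr_pdivrMr ?ltr0n // ltr_pMr // ltr1n.
set e := e0 / 2%:R in nd sol.
have e_gt0 : 0 < e by rewrite divr_gt0 ?ltr0n.
have := @odd_branches _ (Ordinal n_gt0) (fun D => `[< feasible B (moment e) D >])
  (fun D cD => even_feasible B_gt0 nd cD).
rewrite (bigD1 [ffun=> false]) //= oddD.
have -> : `[< feasible B (moment e) (branch [ffun=> false]) >].
  apply/asboolP; exists (on_branch [ffun=> false] (moment e)); split.
  - move=> j; rewrite /on_branch; case: ifP => // _.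
    by rewrite addr_ge0 // exprn_ge0 // ltW.
  - exact: on_branch_supported.
  move=> i; rewrite /lhs big1 ?add0r /on_branch ?ffunE // => k _.
  by rewrite ffunE mulr0.
move=> odd1.
have [b b_neq /asboolP fb] : exists2 b, b != [ffun=> false] &
    `[< feasible B (moment e) (branch b) >].
  apply: contrapT => none; move: odd1; rewrite big1 // => b b_neq.
  by case: asboolP => // fb; case: none; exists b => //; apply/asboolP.
have bU := branch_mx_unit nd fb.
pose v k := \sum_i invmx (branch_mx b) k i.
have v_ge0 k : 0 <= v k by apply: sol.
have one i : lhs B (on_branch b v) i = 1.
  rewrite lhs_on_branch.
  have bE : branch_mx b *m (invmx (branch_mx b) *m (const_mx 1 : 'cV[R]_n)) = const_mx 1.
    by rewrite mulmxA mulmxV // mul1mx.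
  have := congr1 (fun M : 'cV[R]_n => M i 0) bE.
  rewrite [RHS]mxE => <-.
  rewrite mxE; apply: eq_bigr => k _; congr (_ * _); rewrite mxE.
  by apply: eq_bigr => l _; rewrite mxE mulr1.
pose x k := if b k then v k else 0.
have split_lhs i : \sum_k B i k * x k + (if b i then 0 else v i) = 1.
  by rewrite -(one i) /lhs; congr (_ + _); rewrite /on_branch /=; case: (b i).
exists x; split => [k|i|i|].
- rewrite /x; case: ifP => _; rewrite ?lexx ?rpred0 //; split; first exact: v_ge0.
  apply: rpred_sum => i _; apply: rpred_invmx => j l; rewrite mxE /column.
  by case: ifP => // _; rewrite rpred_nat.
- rewrite -[leRHS](split_lhs i) lerDl; case: ifP => // _; exact: v_ge0.
- by have := split_lhs i; rewrite {2}/x; case: ifP; rewrite ?eqxx ?addr0.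
have [k bk] : exists k, b k.
  apply: contrapT => none; case/eqP: b_neq; apply/ffunP => k; rewrite ffunE.
  by apply/negP=> bk; apply: none; exists k.
apply: contrapT => none; have := split_lhs k; rewrite bk big1 => [/eqP|l _].
  by rewrite addr0 eq_sym oner_eq0.
suff -> : x l = 0 by rewrite mulr0.
by apply: contrapT => /eqP xl; apply: none; exists l.
Qed.
End SymmetricEquilibrium.

(** * Mean-field games as symmetric games *)

(** Adding a constant to all payoffs does not change the equilibria and makes the
    matrix positive; a complementary solution, normalized to total weight 1, gives
    every strategy it uses the same, maximal payoff. *)
Lemma symmetric_equilibrium (R : realFieldType) (K : divringClosed R)
    (I : finType) (i0 : I) (B : I -> I -> R) :
    (forall i j, B i j \in K) ->
  exists x : I -> R, [/\ forall i, 0 <= x i, forall i, x i \in K, \sum_i x i = 1 &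
    forall i, \sum_j B i j * x j <= \sum_k x k * \sum_j B k j * x j].
Proof.
move=> BK; pose c := 1 + \sum_i \sum_j `|B i j|.
have normK (u : R) : u \in K -> `|u| \in K.
  by move=> uK; case: (ger0P u) => _; rewrite ?rpredN.
have cK : c \in K.
  by rewrite rpredD ?rpred1 //; do 2!apply: rpred_sum => ? _; apply: normK.
have B_gt i j : 0 < B i j + c.
  rewrite /c addrCA ltr_pwDl ?ltr01 // -lerBlDl sub0r.
  apply: le_trans (ler_norm _) _; rewrite normrN.
  rewrite (bigD1 i) //= (bigD1 j) //= -addrA lerDl addr_ge0 ?sumr_ge0 // => k _.
  exact: sumr_ge0.
pose M : 'M[R]_#|I| := \matrix_(i, j) (B (enum_val i) (enum_val j) + c).
have [|||x [x_K Mx_le Mx_eq [k0 xk0]]] := @complementary_solution _ _ M _ K.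
- by move=> i j; rewrite mxE.
- by apply/card_gt0P; exists i0.
- by move=> i j; rewrite mxE rpredD.
have x_ge0 k : 0 <= x k by case: (x_K k).
pose s := \sum_k x k.
have s_gt0 : 0 < s.
  rewrite /s (bigD1 k0) //= ltr_pwDl ?sumr_ge0 //.
  by rewrite lt0r xk0 x_ge0.
have sK : s \in K by apply: rpred_sum => k _; case: (x_K k).
pose l i := x (enum_rank i) / s.
have sum_l : \sum_i l i = 1.
  rewrite -mulr_suml (reindex _ (onW_bij _ (enum_val_bij I))) /=.
  under eq_bigr do rewrite enum_valK.
  by rewrite divff // gt_eqF.
have l_ge0 i : 0 <= l i by rewrite divr_ge0 // ltW.
have payE i : \sum_j B i j * l j = (\sum_j M (enum_rank i) j * x j) / s - c.
  rewrite -[X in _ - X]mulr1 -sum_l mulr_sumr mulr_suml.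
  rewrite [X in _ - X](reindex _ (onW_bij _ (enum_val_bij I))) -sumrB /=.
  rewrite (reindex _ (onW_bij _ (enum_val_bij I))) /=; apply: eq_bigr => j _.
  by rewrite mxE enum_rankK /l enum_valK mulrDl mulrDl !mulrA addrK.
exists l; split=> // [i|i].
  by rewrite rpredM ?rpredV //; case: (x_K (enum_rank i)).
have -> : \sum_k l k * \sum_j B k j * l j = s^-1 - c.
  rewrite -[RHS]mul1r -sum_l mulr_suml; apply: eq_bigr => k _.
  have [->|lk] := eqVneq (l k) 0; first by rewrite !mul0r.
  rewrite payE Mx_eq ?mul1r //.
  by apply: contraNneq lk; rewrite /l => ->; rewrite mul0r.
by rewrite payE lerD2r ler_pdivrMr // mulVf // gt_eqF.
Qed.

Section MeanFieldGame.
Variables (R : realFieldType) (S A : finType) (T : nat).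
Variables (mu0 : S -> R) (P : nat -> S -> A -> S -> R).
Variables (rbar : nat -> S -> A -> R) (Rbar : nat -> S -> A -> S * A -> R).
Implicit Types (p : nat -> S -> A -> R) (l : nat -> S * A -> R) (v : nat -> S -> R).

(** Time runs over all natural numbers, so that recursions over time need no
    bounded indices. *)
Definition state_law l t s : R :=
  if t is t'.+1 then \sum_s0 \sum_a0 l t' (s0, a0) * P t' s0 a0 s else mu0 s.

(** The occupation measure of [p]; as the dynamics ignore the mean field, it is
    the flow of [p] in every environment. *)
Fixpoint occ p t (x : S * A) : R :=
  p t x.1 x.2 *
  (if t is t'.+1 then \sum_s0 \sum_a0 occ p t' (s0, a0) * P t' s0 a0 x.1 else mu0 x.1).

Definition flow_eq p l t := forall s a, l t (s, a) = p t s a * state_law l t s.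

Lemma occ_flow p t : flow_eq p (occ p) t.
Proof. by case: t. Qed.

Definition mf_reward l t s a : R := rbar t s a + \sum_x l t x * Rbar t s a x.
Definition qval (r : nat -> S -> A -> R) v t s a : R :=
  r t s a + \sum_s' P t s a s' * v t.+1 s'.

Definition total (r : nat -> S -> A -> R) l : R :=
  \sum_(t < T.+1) \sum_s \sum_a l t (s, a) * r t s a.

(** The performance difference identity: the reward collected by a flow falls
    short of the initial value of [v] by the Bellman gaps of [v] along that flow.
    Both directions of the correspondence between certificates and equilibria
    rest on it. *)
Lemma total_telescope r p l v :
    (forall t s, (t <= T)%N -> \sum_a p t s a = 1) ->
    (forall t, (t <= T)%N -> flow_eq p l t) ->
    (forall s, v T.+1 s = 0) ->
  total r l = \sum_s mu0 s * v 0 s -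
    \sum_(t < T.+1) \sum_s \sum_a l t (s, a) * (v t s - qval r v t s a).
Proof.
move=> p1 lE vT.
suff main n : (n <= T.+1)%N ->
    \sum_(t < n) \sum_s \sum_a l t (s, a) * r t s a =
    \sum_s mu0 s * v 0 s
    - \sum_(t < n) \sum_s \sum_a l t (s, a) * (v t s - qval r v t s a)
    - \sum_s state_law l n s * v n s.
  rewrite /total main // [X in _ - _ - X]big1 ?subr0 // => s _.
  by rewrite vT mulr0.
elim: n => [|n IH] ltn; first by rewrite !big_ord0 subr0 subrr.
rewrite !big_ord_recr /= IH 1?ltnW //.
have marg s : \sum_a l n (s, a) = state_law l n s.
  under eq_bigr do rewrite lE //.
  by rewrite -mulr_suml p1 // mul1r.
have -> : \sum_s (\sum_s0 \sum_a0 l n (s0, a0) * P n s0 a0 s) * v n.+1 s =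
    \sum_s \sum_a l n (s, a) * (\sum_s' P n s a s' * v n.+1 s').
  under eq_bigr => s _.
    rewrite mulr_suml; under eq_bigr do rewrite mulr_suml; over.
  rewrite exchange_big /=; apply: eq_bigr => s _.
  rewrite exchange_big /=; apply: eq_bigr => a _.
  by rewrite mulr_sumr; apply: eq_bigr => s' _; rewrite mulrA.
have -> : \sum_s state_law l n s * v n s = \sum_s \sum_a l n (s, a) * v n s.
  by apply: eq_bigr => s _; rewrite -marg mulr_suml.
rewrite opprD -!addrA; congr (_ + (_ + _)).
rewrite -!sumrN -!big_split /=; apply: eq_bigr => s _.
rewrite -!sumrN -!big_split /=; apply: eq_bigr => a _.
rewrite /qval mulrBr mulrDr.
ring.
Qed.

(** Conditions local in time that force [p] to be optimal against its own flow
    [l]: [v] satisfies the Bellman inequalities of the environment [l], tightly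
    wherever [l] is positive. *)
Definition certificate p l v : Prop :=
  [/\ forall t s a, (t <= T)%N -> 0 <= p t s a,
      forall t s, (t <= T)%N -> \sum_a p t s a = 1,
      forall t, (t <= T)%N -> flow_eq p l t,
      forall t s a, (t <= T)%N -> qval (mf_reward l) v t s a <= v t s /\
        (0 < l t (s, a) -> v t s <= qval (mf_reward l) v t s a) &
      forall s, v T.+1 s = 0].

Lemma certificate_ext p l v p' l' v' :
    (forall t s a, (t <= T)%N -> p' t s a = p t s a) ->
    (forall t x, (t <= T)%N -> l' t x = l t x) ->
    (forall t s, (t <= T.+1)%N -> v' t s = v t s) ->
  certificate p l v -> certificate p' l' v'.
Proof.
move=> pE lE vE [p_ge0 p1 flowE v_opt v_end]; split.
- by move=> t s a tT; rewrite pE ?p_ge0.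
- by move=> t s tT; under eq_bigr do rewrite pE //; apply: p1.
- move=> t tT s a; rewrite lE // flowE // pE //; congr (_ * _).
  case: t tT => //= t tT; do 2![apply: eq_bigr => ? _].
  by rewrite lE // ltnW.
- move=> t s a tT; have -> : qval (mf_reward l') v' t s a = qval (mf_reward l) v t s a.
    congr (_ + _ + _); first by apply: eq_bigr => x _; rewrite lE.
    by apply: eq_bigr => s' _; rewrite vE.
  by rewrite vE ?lE //; [apply: v_opt|apply: leqW].
by move=> s; rewrite vE.
Qed.

Hypothesis mu0_ge0 : forall s, 0 <= mu0 s.
Hypothesis P_ge0 : forall t s a s', 0 <= P t s a s'.

Lemma occ_ge0 p t x : (forall t s a, 0 <= p t s a) -> 0 <= occ p t x.
Proof.
move=> p_ge0; elim: t x => [|t IH] x /=; rewrite mulr_ge0 //.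
by do 2!apply: sumr_ge0 => ? _; rewrite mulr_ge0.
Qed.

Section Greedy.
Variables (a0 : A) (r : nat -> S -> A -> R).

(** Backward induction, indexed by the number of steps that remain. *)
Fixpoint value_to_go k s : R :=
  if k is k'.+1 then
    let q a := r (T - k') s a + \sum_s' P (T - k') s a s' * value_to_go k' s' in
    q [arg max_(a > a0) q a]%O
  else 0.
Definition opt_value t := value_to_go (T.+1 - t).
Definition greedy t s := [arg max_(a > a0) qval r opt_value t s a]%O.

Lemma opt_valueE t s : (t <= T)%N ->
  opt_value t s = qval r opt_value t s (greedy t s).
Proof.
by move=> tT; rewrite /greedy /qval /opt_value subSS subSn //= subKn.
Qed.

Lemma opt_value_max t s a : (t <= T)%N -> qval r opt_value t s a <= opt_value t s.
Proof.
move=> tT; rewrite opt_valueE // /greedy.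
by case: (@arg_maxP _ _ _ a0 xpredT (qval r opt_value t s) isT) => b _; apply.
Qed.

Lemma opt_value_rpred (K : divringClosed R) t s :
    (forall t s a, r t s a \in K) -> (forall t s a s', P t s a s' \in K) ->
  opt_value t s \in K.
Proof.
move=> rK PK; rewrite /opt_value; elim: (T.+1 - t)%N s => [|k IH] s /=; first exact: rpred0.
by rewrite rpredD //; apply: rpred_sum => s' _; rewrite rpredM.
Qed.
End Greedy.

Notation det_policy := {ffun 'I_T.+1 * S -> A}.
Definition pure (d : det_policy) t s a : R := (a == d (inord t, s))%:R.

Lemma pure_sum1 d t s : \sum_a pure d t s a = 1.
Proof.
by rewrite (bigD1 (d (inord t, s))) //= /pure eqxx big1 ?addr0 // => a /negPf->.
Qed.

(** The symmetric game: reward of following [d] when the population follows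
    [d'].  Linear rewards make it bilinear under mixing. *)
Definition payoff (d d' : det_policy) : R :=
  total (mf_reward (occ (pure d'))) (occ (pure d)).

Definition mixture (x : det_policy -> R) t (y : S * A) : R :=
  \sum_d x d * occ (pure d) t y.

Lemma state_law_mixture x t s : \sum_d x d = 1 ->
  state_law (mixture x) t s = \sum_d x d * state_law (occ (pure d)) t s.
Proof.
move=> x1; case: t => [|t] /=; first by rewrite -mulr_suml x1 mul1r.
under [RHS]eq_bigr do rewrite mulr_sumr.
rewrite [RHS]exchange_big /=; apply: eq_bigr => s0 _.
under [RHS]eq_bigr do rewrite mulr_sumr.
rewrite [RHS]exchange_big /=; apply: eq_bigr => b _.
by rewrite mulr_suml; apply: eq_bigr => d _; rewrite mulrA.
Qed.

Lemma total_mixture x r : total r (mixture x) = \sum_d x d * total r (occ (pure d)).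
Proof.
rewrite /total; under [RHS]eq_bigr do rewrite mulr_sumr.
rewrite [RHS]exchange_big /=; apply: eq_bigr => t _.
under [RHS]eq_bigr do rewrite mulr_sumr.
rewrite [RHS]exchange_big /=; apply: eq_bigr => s _.
under [RHS]eq_bigr do rewrite mulr_sumr.
rewrite [RHS]exchange_big /=; apply: eq_bigr => a _.
by rewrite mulr_suml; apply: eq_bigr => d _; rewrite mulrA.
Qed.

Lemma mf_reward_mixture x t s a : \sum_d x d = 1 ->
  mf_reward (mixture x) t s a = \sum_d x d * mf_reward (occ (pure d)) t s a.
Proof.
move=> x1; under [RHS]eq_bigr do rewrite mulrDr.
rewrite big_split /= -mulr_suml x1 mul1r; congr (_ + _).
under [RHS]eq_bigr do rewrite mulr_sumr.
rewrite exchange_big /=; apply: eq_bigr => y _.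
by rewrite mulr_suml; apply: eq_bigr => d _; rewrite mulrA.
Qed.

Lemma payoff_mixture x d : \sum_d' x d' = 1 ->
  total (mf_reward (mixture x)) (occ (pure d)) = \sum_d' payoff d d' * x d'.
Proof.
move=> x1; rewrite /payoff /total; under [RHS]eq_bigr do rewrite mulr_suml.
rewrite [RHS]exchange_big /=; apply: eq_bigr => t _.
under [RHS]eq_bigr do rewrite mulr_suml.
rewrite [RHS]exchange_big /=; apply: eq_bigr => s _.
under [RHS]eq_bigr do rewrite mulr_suml.
rewrite [RHS]exchange_big /=; apply: eq_bigr => a _.
rewrite mf_reward_mixture // mulr_sumr; apply: eq_bigr => d' _.
by rewrite mulrCA mulrC.
Qed.

(** The behaviour policy that a flow induces; at states of mass zero the choice of
    action is arbitrary. *)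
Definition conditional (a0 : A) l t s a : R :=
  if \sum_b l t (s, b) == 0 then (a == a0)%:R else l t (s, a) / \sum_b l t (s, b).

(** Kuhn's theorem for this game: a mixture of deterministic policies has the same
    flow as one behaviour policy. *)
Lemma mixture_flow a0 x : (forall d, 0 <= x d) -> \sum_d x d = 1 ->
  forall t, flow_eq (conditional a0 (mixture x)) (mixture x) t.
Proof.
move=> x_ge0 x1 t s a.
have marg : \sum_b mixture x t (s, b) = state_law (mixture x) t s.
  rewrite state_law_mixture // exchange_big /=; apply: eq_bigr => d _.
  rewrite -mulr_sumr; congr (_ * _).
  under eq_bigr do rewrite occ_flow.
  by rewrite -mulr_suml pure_sum1 mul1r.
rewrite /conditional -marg; case: eqP => [m0|/eqP m0]; last by rewrite divfK.
rewrite m0 mulr0; apply: (psumr_eq0P _ m0) => // b _.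
by apply: sumr_ge0 => d _; rewrite mulr_ge0 ?occ_ge0 // => *; apply: ler0n.
Qed.

Lemma conditional_sum1 a0 l t s : \sum_a conditional a0 l t s a = 1.
Proof.
rewrite /conditional; case: eqP => [m0|/eqP m0]; last by rewrite -mulr_suml divff.
by rewrite (bigD1 a0) //= eqxx big1 ?addr0 // => a /negPf->.
Qed.

Lemma conditional_ge0 a0 l t s a : (forall x, 0 <= l t x) -> 0 <= conditional a0 l t s a.
Proof.
move=> l_ge0; rewrite /conditional; case: ifP => _; first exact: ler0n.
by rewrite divr_ge0 ?sumr_ge0.
Qed.

Lemma occ_rpred (K : divringClosed R) p t x :
    (forall s, mu0 s \in K) -> (forall t s a s', P t s a s' \in K) ->
    (forall t s a, p t s a \in K) ->
  occ p t x \in K.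
Proof.
move=> muK PK pK; elim: t x => [|t IH] x /=; rewrite rpredM //.
by do 2!apply: rpred_sum => ? _; rewrite rpredM.
Qed.

(** Mix deterministic policies according to a symmetric equilibrium.  The mixture
    earns at least as much as the greedy policy against the mixed flow, and by
    [total_telescope] the greedy policy earns the whole initial optimal value.  So
    the Bellman gaps, which are nonnegative, sum to zero along the mixed flow. *)
Theorem certificate_exists (K : divringClosed R) (a0 : A) :
    (forall s, mu0 s \in K) -> (forall t s a s', P t s a s' \in K) ->
    (forall t s a, rbar t s a \in K) -> (forall t s a x, Rbar t s a x \in K) ->
  exists p l v, [/\ certificate p l v, forall t s a, p t s a \in K,
    forall t x, l t x \in K & forall t s, v t s \in K].
Proof.
move=> muK PK rK RK.
have occK d t x : occ (pure d) t x \in K.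
  by apply: occ_rpred => // t' s a; apply: rpred_nat.
have rewK l t s a : (forall t x, l t x \in K) -> mf_reward l t s a \in K.
  by move=> lK; rewrite rpredD //; apply: rpred_sum => x _; rewrite rpredM.
have payK d d' : payoff d d' \in K.
  by do 3!apply: rpred_sum => ? _; rewrite rpredM // rewK.
have [x [x_ge0 xK x1 x_best]] := symmetric_equilibrium ([ffun=> a0] : det_policy) payK.
pose l := mixture x; pose p := conditional a0 l.
pose r := mf_reward l; pose v := opt_value a0 r.
have l_ge0 t y : 0 <= l t y.
  by apply: sumr_ge0 => d _; rewrite mulr_ge0 ?occ_ge0 // => *; apply: ler0n.
have lK t y : l t y \in K by apply: rpred_sum => d _; rewrite rpredM.
have pK t s a : p t s a \in K.
  rewrite /p /conditional; case: ifP => _; first exact: rpred_nat.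
  by rewrite rpredM // rpredV rpred_sum.
have vK t s : v t s \in K by apply: opt_value_rpred => // *; apply: rewK.
have lE t : flow_eq p l t by exact: mixture_flow.
have v_end s : v T.+1 s = 0 by rewrite /v /opt_value subnn.
have gap_ge0 t s a : (t <= T)%N -> 0 <= l t (s, a) * (v t s - qval r v t s a).
  by move=> tT; rewrite mulr_ge0 // subr_ge0 opt_value_max.
pose d0 : det_policy := [ffun z : 'I_T.+1 * S => greedy a0 r z.1 z.2].
have best : total r (occ (pure d0)) = \sum_s mu0 s * v 0 s.
  rewrite (@total_telescope _ (pure d0) _ v) //.
  - rewrite [X in _ - X]big1 ?subr0 // => t _; rewrite big1 // => s _; rewrite big1 // => a _.
    rewrite occ_flow /pure ffunE /= inordK ?ltn_ord //.
    case: eqP => [->|_]; last by rewrite !mul0r.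
    by rewrite -opt_valueE ?subrr ?mulr0 // -ltnS.
  - by move=> t s _; apply: pure_sum1.
  - by move=> t _; apply: occ_flow.
have gap0 : \sum_(t < T.+1) \sum_s \sum_a l t (s, a) * (v t s - qval r v t s a) = 0.
  apply: le_anti; rewrite (_ : 0 <= _) ?andbT; last first.
    by do 3![apply: sumr_ge0 => ? _]; apply: gap_ge0; rewrite -ltnS.
  have := x_best d0; rewrite -payoff_mixture // -/l best.
  under [X in _ <= X]eq_bigr do rewrite -payoff_mixture //.
  rewrite -total_mixture -/l (@total_telescope _ p _ v) //.
    by rewrite -[X in X <= _]subr0 lerD2l lerN2.
  by move=> t s _; apply: conditional_sum1.
exists p, l, v; split=> //; split=> // [t s a _|t s _|t s a tT].
- exact: conditional_ge0.
- exact: conditional_sum1.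
split; first exact: opt_value_max.
move=> l_gt0; rewrite -subr_le0.
have tT' : (t < T.+1)%N by [].
have: l t (s, a) * (v t s - qval r v t s a) = 0.
  have sum_ge0 (i : 'I_T.+1) :
      0 <= \sum_s \sum_a l i (s, a) * (v i s - qval r v i s a).
    by do 2![apply: sumr_ge0 => ? _]; apply: gap_ge0; rewrite -ltnS.
  have gt0 := psumr_eq0P (fun i _ => sum_ge0 i) gap0 (i := Ordinal tT') isT.
  have gs := psumr_eq0P (fun s _ => sumr_ge0 _ (fun a _ => gap_ge0 t s a tT)) gt0 (i := s) isT.
  exact: (psumr_eq0P (fun a _ => gap_ge0 t s a tT) gs (i := a) isT).
by move/eqP; rewrite mulf_eq0 gt_eqF //= => /eqP->.
Qed.
End MeanFieldGame.

(** * Expected rewards and soundness of certificates *)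

Section Chain.
Variables (R : realFieldType) (X : finType).
Implicit Types (alpha : X -> R) (kappa : nat -> X -> X -> R) (f : nat -> X -> R).

Definition fcons n (x : X) (w : {ffun 'I_n -> X}) : {ffun 'I_n.+1 -> X} :=
  [ffun i => if unlift ord0 i is Some j then w j else x].

Lemma fcons0 n x (w : {ffun 'I_n -> X}) : fcons x w ord0 = x.
Proof. by rewrite ffunE unlift_none. Qed.

Lemma fconsS n x (w : {ffun 'I_n -> X}) i : fcons x w (lift ord0 i) = w i.
Proof. by rewrite ffunE liftK. Qed.

Lemma sum_fcons n (F : {ffun 'I_n.+1 -> X} -> R) :
  \sum_w F w = \sum_x \sum_w F (fcons x w).
Proof.
rewrite pair_bigA /= (reindex (fun xw => fcons xw.1 xw.2)) //=.
exists (fun w : {ffun 'I_n.+1 -> X} => (w ord0, [ffun i => w (lift ord0 i)])).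
  move=> [x w] _ /=; rewrite fcons0; congr pair; apply/ffunP=> i.
  by rewrite ffunE fconsS.
move=> w _ /=; apply/ffunP=> i; rewrite ffunE.
by case: unliftP => [j|] -> //; rewrite ffunE.
Qed.

Definition path_weight alpha kappa n (w : {ffun 'I_n.+1 -> X}) : R :=
  alpha (w ord0) * \prod_(t < n) kappa t (w (now t)) (w (Defs.next t)).

Lemma path_weight_cons alpha kappa n x (w : {ffun 'I_n.+1 -> X}) :
  path_weight alpha kappa (fcons x w) =
  alpha x * path_weight (kappa 0 x) (fun t => kappa t.+1) w.
Proof.
rewrite /path_weight fcons0 big_ord_recl; congr (_ * (_ * _)).
  rewrite /Defs.next fconsS; congr (kappa _ _ _).
  by rewrite -[RHS](fcons0 x w); congr (fcons x w _); apply: val_inj.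
apply: eq_bigr => t _; rewrite /Defs.next fconsS.
congr (kappa _ _ _); rewrite -[RHS](fconsS x w).
by congr (fcons x w _); apply: val_inj.
Qed.

Fixpoint push alpha kappa t (y : X) : R :=
  if t is t'.+1 then \sum_x push alpha kappa t' x * kappa t' x y else alpha y.

Lemma push_shift alpha kappa t y :
  push alpha kappa t.+1 y =
  push (fun y => \sum_x alpha x * kappa 0%N x y) (fun t => kappa t.+1) t y.
Proof. by elim: t y => //= t IH y; apply: eq_bigr => x _; rewrite -IH. Qed.

Lemma path_weight_sum alpha kappa n : (forall t x, \sum_y kappa t x y = 1) ->
  \sum_(w : {ffun 'I_n.+1 -> X}) path_weight alpha kappa w = \sum_x alpha x.
Proof.
elim: n alpha kappa => [|n IH] alpha kappa k1; rewrite sum_fcons.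
  apply: eq_bigr => x _; rewrite (big_pred1 [ffun=> x]).
    by rewrite /path_weight fcons0 big_ord0 mulr1.
  by move=> w; apply/esym/eqP/ffunP => -[].
apply: eq_bigr => x _; under eq_bigr do rewrite path_weight_cons.
by rewrite -mulr_sumr IH ?k1 ?mulr1.
Qed.

(** By induction on the length: without its first step, a path is weighted as a
    path of the chain that starts from the second marginal. *)
Lemma path_weight_expect alpha kappa f n : (forall t x, \sum_y kappa t x y = 1) ->
  \sum_(w : {ffun 'I_n.+1 -> X}) path_weight alpha kappa w * \sum_(t < n.+1) f t (w t) =
  \sum_(t < n.+1) \sum_x push alpha kappa t x * f t x.
Proof.
elim: n alpha kappa f => [|n IH] alpha kappa f k1; rewrite sum_fcons.
  rewrite big_ord1; apply: eq_bigr => x _; rewrite (big_pred1 [ffun=> x]).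
    by rewrite /path_weight fcons0 big_ord0 mulr1 big_ord1 fcons0.
  by move=> w; apply/esym/eqP/ffunP => -[].
rewrite big_ord_recl /=.
under eq_bigr => x _.
  under eq_bigr => w _.
    rewrite path_weight_cons big_ord_recl fcons0 mulrDr.
    under eq_bigr do rewrite fconsS.
    over.
  rewrite big_split /= -mulr_suml -mulr_sumr path_weight_sum // k1 mulr1.
  over.
rewrite big_split /=; congr (_ + _).
transitivity (\sum_(t < n.+1) \sum_x
    push (fun y => \sum_x alpha x * kappa 0%N x y) (fun t => kappa t.+1) t x * f t.+1 x);
  last by apply: eq_bigr => t _; apply: eq_bigr => x _; rewrite -push_shift.
rewrite -(IH _ _ (fun t => f t.+1)) // exchange_big /=; apply: eq_bigr => w _.
rewrite -mulr_suml /path_weight; congr (_ * _).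
by rewrite mulr_suml; apply: eq_bigr => x _; rewrite mulrA.
Qed.
End Chain.

Lemma dist_ge0 (R : realType) (X : finType) (p : dist R X) x : 0 <= p x.
Proof. by have /andP[/forallP] := pmfP p. Qed.

Lemma dist_sum1 (R : realType) (X : finType) (p : dist R X) : \sum_x p x = 1.
Proof. by have /andP[_ /eqP] := pmfP p. Qed.

Section Verification.
Variables (R : realType) (S A : finType) (T : nat) (G : mfg R S A T).
Variables (rbar : S -> A -> 'I_T.+1 -> R) (Rbar : S -> A -> 'I_T.+1 -> S * A -> R).
Variable Pbar : S -> S -> A -> 'I_T.+1 -> R.
Hypotheses (rewardE : linear_rewards G rbar Rbar).
Hypotheses (transE : mean_field_independent G Pbar).

Definition trans_at t s a s' : R := Pbar s' s a (inord t).
Definition rbar_at t s a : R := rbar s a (inord t).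
Definition Rbar_at t s a x : R := Rbar s a (inord t) x.

(** The transition law is a distribution only once some mean field is supplied. *)
Lemma inhabited_dist : (0 < #|A|)%N -> inhabited (dist R (S * A)%type).
Proof.
case/card_gt0P=> a0 _.
have : is_dist [ffun x : S * A => init G x.1 * (x.2 == a0)%:R].
  apply/andP; split; first by apply/forallP=> x; rewrite ffunE mulr_ge0 ?dist_ge0.
  apply/eqP; rewrite -[RHS](dist_sum1 (init G)) big_pair /=.
  apply: eq_bigr => s _; rewrite (bigD1 a0) //= ffunE /= eqxx mulr1 big1 ?addr0 //.
  by move=> a /negPf neq; rewrite ffunE /= neq mulr0.
by move=> d; split; exact: Dist d.
Qed.

Hypothesis A_gt0 : (0 < #|A|)%N.

Lemma trans_at_ge0 t s a s' : 0 <= trans_at t s a s'.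
Proof. by have [l] := inhabited_dist A_gt0; rewrite /trans_at -(transE _ _ _ _ l) dist_ge0. Qed.

Lemma trans_at_sum1 t s a : \sum_s' trans_at t s a s' = 1.
Proof.
have [l] := inhabited_dist A_gt0; rewrite -[RHS](dist_sum1 (trans G (inord t) s a l)).
by apply: eq_bigr => s' _; rewrite transE.
Qed.

Definition policy_at (pi : policy R S A T) t s a : R := pi (inord t) s a.

(** State and action together form a Markov chain, whose marginals are the
    occupation measures. *)
Lemma expected_rewardE (L : flow R S A T) pi :
  expected_reward G L pi =
  total T (mf_reward rbar_at Rbar_at (fun t => L (inord t)))
    (occ (init G) trans_at (policy_at pi)).
Proof.
pose alpha (x : S * A) := init G x.1 * policy_at pi 0 x.1 x.2.
pose kappa t (x y : S * A) := trans_at t x.1 x.2 y.1 * policy_at pi t.+1 y.1 y.2.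
have kappa1 t x : \sum_y kappa t x y = 1.
  rewrite big_pair /= -[RHS](trans_at_sum1 t x.1 x.2).
  by apply: eq_bigr => s _; rewrite /kappa /= -mulr_sumr dist_sum1 mulr1.
have pushE t x : push alpha kappa t x = occ (init G) trans_at (policy_at pi) t x.
  elim: t x => [|t IH] [s a] /=; first by rewrite mulrC.
  rewrite mulr_sumr big_pair.
  apply: eq_bigr => s0 _; rewrite mulr_sumr; apply: eq_bigr => a0 _.
  by rewrite IH /kappa /=; ring.
pose f t (x : S * A) := mf_reward rbar_at Rbar_at (fun t => L (inord t)) t x.1 x.2.
transitivity (\sum_(w : {ffun 'I_T.+1 -> S * A}) path_weight alpha kappa w * \sum_(t < T.+1) f t (w t)).
  apply: eq_bigr => w _; congr (_ * _).
    rewrite /traj_prob /path_weight big_ord_recl /alpha /kappa big_split /=.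
    rewrite mulrACA /policy_at /trans_at; congr (_ * _ * (_ * _)).
    - by congr (pi _ _ _); apply: val_inj; rewrite /= inordK.
    - apply: eq_bigr => t _; rewrite transE; congr Pbar.
      by apply: val_inj; rewrite /= inordK // ltnS ltnW.
    apply: eq_bigr => t _; congr (pi _ _ _).
    by apply: val_inj; rewrite /= inordK // ltnS.
  by apply: eq_bigr => t _; rewrite rewardE /f /mf_reward /rbar_at /Rbar_at inord_val.
rewrite path_weight_expect //; apply: eq_bigr => t _.
by rewrite big_pair; do 2![apply: eq_bigr => ? _]; rewrite pushE.
Qed.

(** Weak duality: by [total_telescope] no policy earns more than the initial value
    of [v], because all Bellman gaps are nonnegative, and [p] earns exactly that
    value, because the gaps vanish along its flow. *)
Theorem certificate_sound p l v :
    certificate T (init G) trans_at rbar_at Rbar_at p l v ->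
  exists (pi : policy R S A T) (L : flow R S A T),
    [/\ forall (t : 'I_T.+1) s a, pi t s a = p t s a,
        forall (t : 'I_T.+1) x, L t x = l t x & nash_equilibrium G pi L].
Proof.
case=> p_ge0 p1 lE v_best v_end.
have leT (t : 'I_T.+1) : (t <= T)%N by rewrite -ltnS.
have pi_ok (t : 'I_T.+1) s : is_dist [ffun a => p t s a].
  apply/andP; split; first by apply/forallP=> a; rewrite ffunE p_ge0.
  by under eq_bigr do rewrite ffunE; rewrite p1.
pose pi : policy R S A T := fun t s => Dist (pi_ok t s).
have piE (t : 'I_T.+1) s a : pi t s a = p t s a by rewrite /= ffunE.
have lE0 t s : (t <= T)%N -> \sum_a l t (s, a) = state_law (init G) trans_at l t s.
  move=> tT; under eq_bigr do rewrite lE //.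
  by rewrite -mulr_suml p1 // mul1r.
have law_ok t : (t <= T)%N -> (forall s, 0 <= state_law (init G) trans_at l t s) /\
    \sum_s state_law (init G) trans_at l t s = 1.
  elim: t => [|t IH] tT; first by split=> [s|]; [exact: dist_ge0|exact: dist_sum1].
  have [law_ge0 law1] := IH (ltnW tT); split=> [s|] /=.
    do 2![apply: sumr_ge0 => ? _]; apply: mulr_ge0; last exact: trans_at_ge0.
    rewrite lE; last exact: ltnW.
    by apply: mulr_ge0; [apply: p_ge0; apply: ltnW|apply: law_ge0].
  rewrite exchange_big /= -[RHS]law1; apply: eq_bigr => s _.
  rewrite exchange_big -(lE0 t s (ltnW tT)); apply: eq_bigr => a _.
  by rewrite -mulr_sumr trans_at_sum1 mulr1.
have L_ok (t : 'I_T.+1) : is_dist [ffun x => l t x].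
  have [law_ge0 law1] := law_ok t (leT t); apply/andP; split.
    by apply/forallP=> -[s a]; rewrite ffunE lE // mulr_ge0 ?p_ge0.
  under eq_bigr do rewrite ffunE.
  rewrite big_pair /= -law1; apply/eqP.
  by apply: eq_bigr => s _; rewrite lE0.
pose L : flow R S A T := fun t => Dist (L_ok t).
have LE (t : 'I_T.+1) x : L t x = l t x by rewrite /= ffunE.
exists pi, L; split => //; split; last split.
- pose r := mf_reward rbar_at Rbar_at (fun t => L (inord t)).
  have rE t s a : (t <= T)%N -> qval trans_at r v t s a =
      qval trans_at (mf_reward rbar_at Rbar_at l) v t s a.
    move=> tT; congr (_ + _ + _); apply: eq_bigr => x _.
    by rewrite LE inordK.
  have piT t s a : (t <= T)%N -> policy_at pi t s a = p t s a.
    by move=> tT; rewrite /policy_at piE inordK.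
  have occE t s a : (t <= T)%N -> occ (init G) trans_at (policy_at pi) t (s, a) = l t (s, a).
    elim: t s a => [|t IH] s a tT; rewrite lE // /= piT //; congr (_ * _).
    do 2![apply: eq_bigr => ? _]; rewrite IH // ltnW //.
  have pol1 pi' t s : (t <= T)%N -> \sum_a policy_at pi' t s a = 1 by rewrite dist_sum1.
  have occ_eq pi' t : (t <= T)%N ->
    flow_eq (init G) trans_at (policy_at pi') (occ (init G) trans_at (policy_at pi')) t.
    by move=> _; apply: occ_flow.
  move=> pi'; rewrite !expected_rewardE -/r.
  rewrite !(@total_telescope _ _ _ _ _ _ r _ _ v (pol1 _) (occ_eq _) v_end).
  rewrite lerD2l lerN2 [X in X <= _](_ : _ = 0).
    apply: sumr_ge0 => t _; apply: sumr_ge0 => s _; apply: sumr_ge0 => a _.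
    apply: mulr_ge0.
      apply: occ_ge0 => *; [exact: dist_ge0|exact: trans_at_ge0|exact: dist_ge0].
    by rewrite subr_ge0 rE //; case: (v_best t s a (leT t)).
  rewrite big1 // => t _; rewrite big1 // => s _; rewrite big1 // => a _.
  rewrite occE // rE //.
  have [ge le] := v_best t s a (leT t).
  have : 0 <= l t (s, a).
    by have [law_ge0 _] := law_ok t (leT t); rewrite lE // mulr_ge0 ?p_ge0.
  rewrite le0r => /predU1P[->|/le v_le]; first by rewrite mul0r.
  have -> : v t s = qval trans_at (mf_reward rbar_at Rbar_at l) v t s a.
    by apply: le_anti; rewrite v_le ge.
  by rewrite subrr mulr0.
- by move=> s a; rewrite LE piE lE // mulrC.
move=> t s' a'; rewrite LE piE lE; last exact: leT.
rewrite (_ : nat_of_ord (Defs.next t) = t.+1) //; congr (_ * _).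
apply: eq_bigr => s _; apply: eq_bigr => a _; rewrite LE transE.
congr (_ * Pbar _ _ _ _).
by apply: val_inj; rewrite /= inordK // ltnS ltnW.
Qed.
End Verification.

(** * Program execution and bounded formulas *)

Section Runs.
Variable R : realType.
Implicit Types (m : memory R) (p q : prog) (b : bexp).

(** Quantifying over the continuation makes executions compose. *)
Definition runs p m m' : Prop :=
  forall k, exists n, iter n (@step R) (p :: k, m) = (k, m').

Lemma runs_terminates p m m' : runs p m m' -> terminates_with p m m'.
Proof. exact. Qed.

Lemma runs_skip m : runs Skip m m.
Proof. by move=> k; exists 1%N. Qed.

Lemma runs_iset m x e : runs (ISet x e) m (iupdate m x (ieval m e)).
Proof. by move=> k; exists 1%N. Qed.

Lemma runs_rset m x js e :
  runs (RSet x js e) m (rupdate m x (map (ieval m) js) (reval m e)).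
Proof. by move=> k; exists 1%N. Qed.

Lemma runs_seq m1 p q m m2 : runs p m m1 -> runs q m1 m2 -> runs (Seq p q) m m2.
Proof.
move=> rp rq k; have [n1 e1] := rp (q :: k); have [n2 e2] := rq k.
by exists (n2 + n1).+1; rewrite iterSr /= iterD e1.
Qed.

Lemma runs_if b p q m m' :
  runs (if beval m b then p else q) m m' -> runs (If b p q) m m'.
Proof. by move=> r k; have [n e] := r k; exists n.+1; rewrite iterSr. Qed.

Lemma runs_while_false b p m : ~~ beval m b -> runs (While b p) m m.
Proof. by move=> /negPf nb k; exists 1%N; rewrite /= nb. Qed.

Lemma runs_while_true m1 b p m m2 :
  beval m b -> runs p m m1 -> runs (While b p) m1 m2 -> runs (While b p) m m2.
Proof.
move=> tb rp rw k; have [n1 e1] := rp (While b p :: k); have [n2 e2] := rw k.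
by exists (n2 + n1).+1; rewrite iterSr /= tb iterD e1.
Qed.

Lemma memory_ext m m' :
  ireg m =1 ireg m' -> (forall x js, rarr m x js = rarr m' x js) -> m = m'.
Proof.
case: m m' => [i a] [i' a'] /= /funext-> aE; congr Memory.
by apply/funext=> x; apply/funext.
Qed.

Lemma iupdateK m x i j : iupdate (iupdate m x i) x j = iupdate m x j.
Proof. by apply: memory_ext => //= y; case: eqP. Qed.

Lemma iupdate_id m x i : ireg m x = i -> iupdate m x i = m.
Proof. by move=> <-; apply: memory_ext => //= y; case: eqP => [->|]. Qed.

Lemma rupdateK m x js u v : rupdate (rupdate m x js u) x js v = rupdate m x js v.
Proof. by apply: memory_ext => //= y ks; case: (_ && _). Qed.

Definition ILt (e1 e2 : iexp) : bexp := BNot (BIle e2 e1).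

(** The loop register is 0 before and after the loop, so that a loop leaves no
    trace in the registers. *)
Definition For (x : nat) (n : iexp) (body : prog) : prog :=
  Seq (While (ILt (IReg x) n) (Seq body (ISet x (IAdd (IReg x) (IConst 1)))))
      (ISet x (IConst 0)).

(** [M i] is the memory after [i] rounds, with the loop register reset to 0. *)
Lemma runs_for x e n body (M : nat -> memory R) :
    (forall i, (i <= n)%N -> ireg (M i) x = 0%N) ->
    (forall i, (i <= n)%N -> ieval (iupdate (M i) x i) e = n) ->
    (forall i, (i < n)%N -> runs body (iupdate (M i) x i) (iupdate (M i.+1) x i)) ->
  runs (For x e body) (M 0%N) (M n).
Proof.
move=> M0 en step_i.
apply: (@runs_seq (iupdate (M n) x n)); last first.
  rewrite -[X in runs _ _ X](iupdate_id (M0 n (leqnn n))).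
  by rewrite -(iupdateK (M n) x n 0); apply: runs_iset.
suff loop k i : (i + k = n)%N ->
    runs (While (ILt (IReg x) e) (Seq body (ISet x (IAdd (IReg x) (IConst 1)))))
      (iupdate (M i) x i) (iupdate (M n) x n).
  by rewrite -{1}(iupdate_id (M0 0%N (leq0n n))); apply: (loop n).
elim: k i => [|k IH] i ikn.
  rewrite addn0 in ikn; rewrite ikn; apply: runs_while_false => /=.
  by rewrite en // eqxx negbK leqnn.
have lt_in : (i < n)%N by rewrite -ikn addnS ltnS leq_addr.
apply: (@runs_while_true (iupdate (M i.+1) x i.+1)).
- by rewrite /= en ?eqxx -?ltnNge // ltnW.
- apply: runs_seq (step_i i lt_in) _.
  have := runs_iset (iupdate (M i.+1) x i) x (IAdd (IReg x) (IConst 1)).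
  by rewrite /= eqxx addn1 iupdateK.
by apply: IH; rewrite addSnnS.
Qed.
End Runs.

(** Sums and quantifiers over index ranges.  [TSum r k] and [FAll r k] let an index
    run below the content of register [r] plus [k], and hold it in the register
    [bound_reg d], where [d] is the number of enclosing binders.  [FSign true]
    states that a term is zero, [FSign false] that it is nonnegative. *)
Inductive term :=
| TBase of rexp
| TAdd of term & term
| TSum of nat & nat & term.

Inductive form :=
| FSign of bool & term
| FAnd of form & form
| FGuard of bexp & form
| FAll of nat & nat & form.

Definition bound_reg d := (20 + d)%N.

(** The register that records whether all checks so far have succeeded, and the
    array whose cell [::] sums up the term being evaluated.  Formulas may mention
    neither, which the cleanness predicates below express. *)
Definition flag := 6%N.
Definition acc := 7%N.

Fixpoint iclean (e : iexp) : bool :=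
  match e with
  | IConst _ => true
  | IReg x => x != flag
  | IAdd e1 e2 | ISub e1 e2 | IMul e1 e2 | IDiv e1 e2 | IMod e1 e2 =>
      iclean e1 && iclean e2
  end.

Fixpoint rclean (e : rexp) : bool :=
  match e with
  | RZero | ROne => true
  | RCell x js => (x != acc) && all iclean js
  | RAdd e1 e2 | RSub e1 e2 | RMul e1 e2 | RDiv e1 e2 => rclean e1 && rclean e2
  end.

Fixpoint bclean (b : bexp) : bool :=
  match b with
  | BIle e1 e2 => iclean e1 && iclean e2
  | BRle e1 e2 => rclean e1 && rclean e2
  | BNot b => bclean b
  | BAnd b1 b2 => bclean b1 && bclean b2
  end.

(** Loops need their registers to be 0 at the start; a bound on the nesting leaves
    only finitely many registers to reset. *)
Definition max_depth := 6%N.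

Fixpoint tclean d (t : term) : bool :=
  match t with
  | TBase e => rclean e
  | TAdd t1 t2 => tclean d t1 && tclean d t2
  | TSum r _ t => [&& (r < 3)%N, (d < max_depth)%N & tclean d.+1 t]
  end.

Fixpoint fclean d (f : form) : bool :=
  match f with
  | FSign _ t => tclean d t
  | FAnd f1 f2 => fclean d f1 && fclean d f2
  | FGuard b f => bclean b && fclean d f
  | FAll r _ f => [&& (r < 3)%N, (d < max_depth)%N & fclean d.+1 f]
  end.

Definition range r k := IAdd (IReg r) (IConst k).
Definition acc_cell := RCell acc [::].

Fixpoint add_term d (t : term) : prog :=
  match t with
  | TBase e => RSet acc [::] (RAdd acc_cell e)
  | TAdd t1 t2 => Seq (add_term d t1) (add_term d t2)
  | TSum r k t => For (bound_reg d) (range r k) (add_term d.+1 t)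
  end.

Fixpoint check_form d (f : form) : prog :=
  match f with
  | FSign eq0 t =>
      Seq (add_term d t)
        (Seq (If (BAnd (BRle RZero acc_cell)
                   (if eq0 then BRle acc_cell RZero else BRle RZero RZero))
                Skip (ISet flag (IConst 0)))
             (RSet acc [::] RZero))
  | FAnd f1 f2 => Seq (check_form d f1) (check_form d f2)
  | FGuard b f => If b (check_form d f) Skip
  | FAll r k f => For (bound_reg d) (range r k) (check_form d.+1 f)
  end.

Section Meaning.
Variable R : realType.
Implicit Type m : memory R.

Fixpoint teval d m (t : term) : R :=
  match t with
  | TBase e => reval m e
  | TAdd t1 t2 => teval d m t1 + teval d m t2
  | TSum r k t => \sum_(i < ireg m r + k) teval d.+1 (iupdate m (bound_reg d) i) t
  end.

Fixpoint feval d m (f : form) : bool :=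
  match f with
  | FSign eq0 t => (0 <= teval d m t) && (eq0 ==> (teval d m t <= 0))
  | FAnd f1 f2 => feval d m f1 && feval d m f2
  | FGuard b f => beval m b ==> feval d m f
  | FAll r k f =>
      [forall i : 'I_(ireg m r + k), feval d.+1 (iupdate m (bound_reg d) i) f]
  end.

Fixpoint holds d m (f : form) : Prop :=
  match f with
  | FSign eq0 t => if eq0 then teval d m t = 0 else 0 <= teval d m t
  | FAnd f1 f2 => holds d m f1 /\ holds d m f2
  | FGuard b f => beval m b -> holds d m f
  | FAll r k f =>
      forall i, (i < ireg m r + k)%N -> holds d.+1 (iupdate m (bound_reg d) i) f
  end.

Lemma fevalP d m f : reflect (holds d m f) (feval d m f).
Proof.
elim: f d m => [[] t|f1 IH1 f2 IH2|b f IH|r k f IH] d m /=.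
- by rewrite -eq_le eq_sym; apply: eqP.
- by rewrite andbT; apply: idP.
- by apply: (iffP andP) => -[/IH1 h1 /IH2 h2].
- by apply: (iffP implyP) => h /h/IH.
apply: (iffP forallP) => [h i lti|h i]; last exact/IH/h.
exact/IH/(h (Ordinal lti)).
Qed.

(** The memory [m] during a check, with outcome [c] so far and running sum [v]. *)
Definition scratch m (c : bool) (v : R) : memory R :=
  rupdate (iupdate m flag c) acc [::] v.

Lemma iupdate_scratch m c v x i : x != flag ->
  iupdate (scratch m c v) x i = scratch (iupdate m x i) c v.
Proof.
by move=> /negPf neq; apply: memory_ext => //= y; case: eqP => [->|//]; rewrite neq.
Qed.

Lemma ieval_scratch m c v e : iclean e -> ieval (scratch m c v) e = ieval m e.
Proof.
elim: e => //= [x /negPf->//|||||] e1 IH1 e2 IH2 /andP[c1 c2];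
by rewrite (IH1 c1) (IH2 c2).
Qed.

Lemma reval_scratch m c v e : rclean e -> reval (scratch m c v) e = reval m e.
Proof.
elim: e => //= [x js /andP[/negPf-> cjs]||||].
2-5: by move=> e1 IH1 e2 IH2 /andP[c1 c2]; rewrite (IH1 c1) (IH2 c2).
congr rarr; elim: js cjs => //= e js IH /andP[ce cjs].
by rewrite ieval_scratch // IH.
Qed.

Lemma beval_scratch m c v b : bclean b -> beval (scratch m c v) b = beval m b.
Proof.
elim: b => //= [e1 e2 /andP[c1 c2]|e1 e2 /andP[c1 c2]|b IH cb|b1 IH1 b2 IH2 /andP[c1 c2]].
- by rewrite !ieval_scratch.
- by rewrite !reval_scratch.
- by rewrite IH.
by rewrite IH1 // IH2.
Qed.

Definition unbound d m := forall k, (d <= k < max_depth)%N -> ireg m (bound_reg k) = 0%N.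

Lemma unbound_step d m i : unbound d m -> unbound d.+1 (iupdate m (bound_reg d) i).
Proof.
by move=> um k /andP[dk kD] /=; rewrite eqn_add2l gtn_eqF ?um // kD ltnW.
Qed.

Lemma runs_add_term d m c v t : tclean d t -> unbound d m ->
  runs (add_term d t) (scratch m c v) (scratch m c (v + teval d m t)).
Proof.
elim: t d m v => [e|t1 IH1 t2 IH2|r k t IH] d m v /=.
- move=> ce _; have := runs_rset (scratch m c v) acc [::] (RAdd acc_cell e).
  by rewrite /= reval_scratch // rupdateK.
- move=> /andP[c1 c2] um; apply: runs_seq (IH1 d m v c1 um) _.
  by rewrite addrA; apply: IH2.
move=> /and3P[r3 dD ct] um; set n := (ireg m r + k)%N.
pose F i := teval d.+1 (iupdate m (bound_reg d) i) t.
pose M i := scratch m c (v + \sum_(j < i) F j).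
have -> : scratch m c v = M 0%N by rewrite /M big_ord0 addr0.
apply: (@runs_for _ _ _ n _ M) => [i _|i _|i lti].
- by rewrite /M /=; apply: um; rewrite leqnn.
- by rewrite /M /= !(ltn_eqF (leq_trans r3 _)).
have := IH d.+1 (iupdate m (bound_reg d) i) (v + \sum_(j < i) F j) ct (unbound_step _ um).
by rewrite /M big_ord_recr /= addrA !iupdate_scratch.
Qed.

Lemma runs_check_form d m c f : fclean d f -> unbound d m ->
  runs (check_form d f) (scratch m c 0) (scratch m (c && feval d m f) 0).
Proof.
elim: f d m c => [eq0 t|f1 IH1 f2 IH2|b f IH|r k f IH] d m c /=.
- move=> ct um; have := runs_add_term c 0 ct um; rewrite add0r => r1.
  apply: runs_seq r1 _; set v := teval d m t.
  apply: (@runs_seq _ (scratch m (c && (0 <= v) && (eq0 ==> (v <= 0))) v)).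
    apply: runs_if; rewrite /=.
    have -> : beval (scratch m c v) (if eq0 then BRle acc_cell RZero else BRle RZero RZero)
        = (eq0 ==> (v <= 0)) by case: eq0; rewrite /= ?eqxx ?lexx.
    rewrite -andbA; case: andP => _ /=; first by rewrite andbT; apply: runs_skip.
    have := runs_iset (scratch m c v) flag (IConst 0); rewrite /= andbF.
    by rewrite /scratch (_ : iupdate (rupdate _ _ _ _) _ _ =
      rupdate (iupdate (iupdate m flag c) flag 0) acc [::] v) // iupdateK.
  rewrite andbA; set c' := (_ && _).
  have := runs_rset (scratch m c' v) acc [::] RZero.
  by rewrite /= /scratch rupdateK.
- move=> /andP[c1 c2] um; apply: runs_seq (IH1 d m c c1 um) _.
  by rewrite andbA; apply: IH2.
- move=> /andP[cb cf] um; apply: runs_if; rewrite beval_scratch //.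
  by case: beval => /=; [apply: IH|rewrite andbT; apply: runs_skip].
move=> /and3P[r3 dD cf] um; set n := (ireg m r + k)%N.
pose F i := feval d.+1 (iupdate m (bound_reg d) i) f.
pose M i := scratch m (c && [forall j : 'I_i, F j]) 0.
have -> : scratch m c 0 = M 0%N.
  by rewrite /M (_ : [forall j, _] = true) ?andbT //; apply/forallP => -[].
apply: (@runs_for _ _ _ n _ M) => [i _|i _|i lti].
- by rewrite /M /=; apply: um; rewrite leqnn.
- by rewrite /M /= !(ltn_eqF (leq_trans r3 _)).
have := IH d.+1 (iupdate m (bound_reg d) i) (c && [forall j : 'I_i, F j]) cf (unbound_step _ um).
rewrite -andbA (_ : [forall j : 'I_i, F j] && _ = [forall j : 'I_i.+1, F j]).
  by rewrite /M !iupdate_scratch.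
apply/andP/forallP => [[/forallP Fi Fl] j|Fa].
  have := ltn_ord j; rewrite ltnS leq_eqVlt => /predU1P[->|ji] //.
  exact: (Fi (Ordinal ji)).
by split; [apply/forallP=> j; apply: (Fa (widen_ord (leqnSn i) j))|apply: (Fa ord_max)].
Qed.
End Meaning.

(** * Straight-line programs coded by numbers *)

Definition counter := 3%N.
Definition code := 4%N.
Definition digit := 5%N.
Definition work := 8%N.

(** The registers [index_reg 0], ..., [index_reg 5] address the cells used by the
    instructions: the first one the work cell, the others its partner, an input
    cell or an output cell. *)
Definition index_reg i := (10 + i)%N.
Definition index_args k := map (fun i => IReg (index_reg i.+1)) (iota 0 k).
Definition work_cell := RCell work [:: IReg (index_reg 0)].
Definition work_arg := RCell work (index_args 1).
Definition set_work e := RSet work [:: IReg (index_reg 0)] e.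

(** [Skip] stands first so that no instruction of use has the digit 0, which is
    lost at the head of a number.  The digits of the others are: 1 to 6 to reset
    an index register, 7 to 12 to increment it, 13 for the constant 1, 14 and 15
    for subtraction and division, [16 + y] to load from the input array [y], and
    again [16 + y] to store into the array [y] when [y] is 4, 5 or 6. *)
Definition instructions : seq prog :=
  Skip :: [seq ISet (index_reg i) (IConst 0) | i <- iota 0 6]
  ++ [seq ISet (index_reg i) (IAdd (IReg (index_reg i)) (IConst 1)) | i <- iota 0 6]
  ++ [:: set_work ROne; set_work (RSub work_cell work_arg);
         set_work (RDiv work_cell work_arg);
         set_work (RCell 0 (index_args 1)); set_work (RCell 1 (index_args 3));
         set_work (RCell 2 (index_args 5)); set_work (RCell 3 (index_args 4));
         RSet 4 (index_args 3) work_cell; RSet 5 (index_args 3) work_cell;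
         RSet 6 (index_args 3) work_cell].

Definition base := size instructions.

Fixpoint dispatch k ps : prog :=
  if ps is p :: ps' then If (BIle (IReg digit) (IConst k)) p (dispatch k.+1 ps')
  else Skip.

Definition decode : prog :=
  While (BIle (IConst 1) (IReg code))
    (Seq (ISet digit (IMod (IReg code) (IConst base)))
      (Seq (ISet code (IDiv (IReg code) (IConst base))) (dispatch 0 instructions))).

(** Least significant digit first, as this is the order of decoding. *)
Fixpoint encode (ds : seq nat) : nat :=
  if ds is d :: ds' then (d + encode ds' * base)%N else 0%N.

Definition proper (ds : seq nat) := all (fun d => 0 < d < base)%N ds.

Definition scratch_regs := [:: code; digit] ++ map index_reg (iota 0 6).
Definition scratch_arrays := [:: 4; 5; 6; work]%N.
Definition confined p :=
  match p with
  | Skip => true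
  | ISet x _ => x \in map index_reg (iota 0 6)
  | RSet y _ _ => y \in scratch_arrays
  | _ => false
  end.

Section Decode.
Variable R : realType.
Implicit Types (m : memory R) (ds : seq nat).

Definition act m p : memory R :=
  match p with
  | ISet x e => iupdate m x (ieval m e)
  | RSet x js e => rupdate m x (map (ieval m) js) (reval m e)
  | _ => m
  end.

Lemma confined_nth d : confined (nth Skip instructions d).
Proof.
have /(all_nthP Skip) h : all confined instructions by [].
by have [/h//|ge] := ltnP d base; rewrite nth_default.
Qed.

Lemma runs_act m p : confined p -> runs p m (act m p).
Proof. by case: p => // *; [apply: runs_skip|apply: runs_iset|apply: runs_rset]. Qed.

Lemma runs_dispatch m k j ps : all confined ps -> ireg m digit = (k + j)%N ->
  runs (dispatch k ps) m (act m (nth Skip ps j)).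
Proof.
elim: ps k j => [|p ps IH] k j /=; first by rewrite nth_nil => *; apply: runs_skip.
move=> /andP[cp cps] dE; apply: runs_if; rewrite /= dE.
case: j dE => [|j] dE; first by rewrite addn0 leqnn; apply: runs_act.
by rewrite addnS leqNgt ltnS leq_addr /=; apply: IH => //; rewrite dE addnS.
Qed.

Definition frame m m' : Prop :=
  (forall x, x \notin scratch_regs -> ireg m' x = ireg m x) /\
  (forall y js, y \notin scratch_arrays -> rarr m' y js = rarr m y js).

Lemma frame_refl m : frame m m. Proof. by []. Qed.

Lemma frame_trans m1 m m2 : frame m m1 -> frame m1 m2 -> frame m m2.
Proof.
by move=> [i1 a1] [i2 a2]; split=> [x xN|y js yN]; rewrite ?i2 ?a2 ?i1 ?a1.
Qed.

Lemma frame_iupdate m x i : x \in scratch_regs -> frame m (iupdate m x i).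
Proof. by move=> xin; split=> // y /=; case: eqP => // ->; rewrite xin. Qed.

Lemma frame_act m p : confined p -> frame m (act m p).
Proof.
case: p => //= [x e xin|x js e xin]; first by apply: frame_iupdate; rewrite /scratch_regs mem_cat xin orbT.
split=> // y ks; rewrite /=; case: eqP => //= ->; by rewrite xin.
Qed.

Lemma act_code m p : confined p -> ireg (act m p) code = ireg m code.
Proof. by case: p => //= x e; case: eqP => // <-. Qed.

(** Execution of the instructions [ds].  The quantifier over [c] abstracts from
    the undecoded rest of the number, held in the register [code], on which no
    instruction depends. *)
Fixpoint performs ds m m' : Prop :=
  if ds is d :: ds' then
    exists c, performs ds'
      (act (iupdate (iupdate m digit d) code c) (nth Skip instructions d)) m'
  else m' = m.

Lemma performs_cat ds1 ds2 m m' :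
  performs (ds1 ++ ds2) m m' <-> exists2 m1, performs ds1 m m1 & performs ds2 m1 m'.
Proof.
elim: ds1 m => [|d ds1 IH] m /=; first by split=> [h|[_ ->]]; [exists m|].
split=> [[c /IH[m1 h1 h2]]|[m1 [c h1] h2]]; first by exists m1 => //; exists c.
by exists c; apply/IH; exists m1.
Qed.

Lemma performs_frame ds m m' : performs ds m m' -> frame m m'.
Proof.
elim: ds m => [|d ds IH] m /=; first by move=> ->; apply: frame_refl.
move=> [c /IH]; apply: frame_trans; apply: (frame_trans _ (frame_act _ (confined_nth d))).
by apply: (@frame_trans (iupdate m digit d)); apply: frame_iupdate.
Qed.

Lemma encode_inj_step d ds : (0 < d < base)%N ->
  [/\ (0 < encode (d :: ds))%N, (encode (d :: ds) %% base)%N = d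
    & (encode (d :: ds) %/ base)%N = encode ds].
Proof.
move=> /andP[d0 db] /=; rewrite addn_gt0 d0; split=> //.
  by rewrite addnC modnMDl modn_small.
by rewrite addnC divnMDl // divn_small // addn0.
Qed.

(** Every number is decoded in finitely many steps, and the code of a proper list
    of instructions is decoded to this list. *)
Lemma runs_decode m : exists ds m', [/\ runs decode m m', performs ds m m' &
  forall ds0, proper ds0 -> encode ds0 = ireg m code -> ds = ds0].
Proof.
have [n] := ubnP (ireg m code); elim: n m => // n IH m; rewrite ltnS => le_n.
have [c0|c_gt0] := posnP (ireg m code).
  exists [::], m; split=> //; first by apply: runs_while_false; rewrite /= c0.
  by case=> // d ds /= /andP[/andP[d0 _] _]; rewrite c0; case: d d0.
set d := (ireg m code %% base)%N; set c := (ireg m code %/ base)%N.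
pose m1 := act (iupdate (iupdate m digit d) code c) (nth Skip instructions d).
have m1c : ireg m1 code = c by rewrite act_code ?confined_nth.
have [|ds [m' [rm' pm' uniq]]] := IH m1.
  by rewrite m1c; apply: leq_trans le_n; rewrite ltn_Pdiv.
exists (d :: ds), m'; split; last first.
- move=> [|d0 ds0]; first by move=> _ /= c0; rewrite -c0 in c_gt0.
  move=> /andP[d0P ds0P] e0; have [_ dE cE] := encode_inj_step ds0 d0P.
  by rewrite /d -e0 dE (uniq ds0) // m1c /c -e0 cE.
- by exists c.
apply: (runs_while_true _ _ rm'); first by [].
apply: runs_seq (runs_iset _ _ _) _; apply: runs_seq (runs_iset _ _ _) _.
by apply: (@runs_dispatch _ 0 d).
Qed.

End Decode.

(** * The field of computable reals *)

(** What a straight-line program can compute from the input arrays of [m0], with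
    no assumption on the other contents of the memory. *)
Section Reach.
Variables (R : realType) (m0 : memory R).
Implicit Types (m : memory R) (ds : seq nat).

Definition same_input m := forall y js, (y < 4)%N -> rarr m y js = rarr m0 y js.

Lemma same_input_frame m m' : frame m m' -> same_input m -> same_input m'.
Proof.
by move=> [_ fa] im y js y4; rewrite fa ?im //; case: y y4 => [|[|[|[|]]]].
Qed.

Definition set_reg i n := i.+1 :: nseq n (i + 7)%N.

Arguments performs : simpl never.
Fixpoint set_regs i (ns : seq nat) :=
  if ns is n :: ns' then set_reg i n ++ set_regs i.+1 ns' else [::].

Lemma zero_instruction i : (i < 6)%N ->
  nth Skip instructions i.+1 = ISet (index_reg i) (IConst 0).
Proof. by case: i => [|[|[|[|[|[|]]]]]]. Qed.

Lemma incr_instruction i : (i < 6)%N -> nth Skip instructions (i + 7) =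
  ISet (index_reg i) (IAdd (IReg (index_reg i)) (IConst 1)).
Proof. by case: i => [|[|[|[|[|[|]]]]]]. Qed.

Lemma proper_cat ds1 ds2 : proper (ds1 ++ ds2) = proper ds1 && proper ds2.
Proof. exact: all_cat. Qed.

Lemma proper_set_regs i ns : (i + size ns <= 6)%N -> proper (set_regs i ns).
Proof.
elim: ns i => [|n ns IH] i //= lti.
have i6 : (i < 6)%N by apply: leq_trans lti; rewrite addnS ltnS leq_addr.
rewrite proper_cat IH ?addSnnS // andbT.
by rewrite /proper /= all_nseq; case: i i6 {lti} => [|[|[|[|[|[|]]]]]] //= _; rewrite orbT.
Qed.

Lemma performs_incr i n m m' : (i < 6)%N -> performs (nseq n (i + 7)%N) m m' ->
  [/\ ireg m' (index_reg i) = (ireg m (index_reg i) + n)%N,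
      forall j, j != i -> ireg m' (index_reg j) = ireg m (index_reg j) &
      rarr m' = rarr m].
Proof.
move=> i6; elim: n m => [|n IH] m; first by move=> ->; rewrite addn0.
case=> c; rewrite incr_instruction // => /IH[ri rj ra]; split=> [|j ji|].
- by rewrite ri /= eqxx addn1 addSnnS.
- by rewrite rj // /= eqn_add2l (negPf ji).
by rewrite ra.
Qed.

Lemma performs_set_reg i n m m' : (i < 6)%N -> performs (set_reg i n) m m' ->
  [/\ ireg m' (index_reg i) = n,
      forall j, j != i -> ireg m' (index_reg j) = ireg m (index_reg j) &
      rarr m' = rarr m].
Proof.
move=> i6 [c]; rewrite zero_instruction // => /(performs_incr i6)[ri rj ra].
split=> [|j ji|]; first by rewrite ri /= eqxx.
  by rewrite rj // /= eqn_add2l (negPf ji).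
by rewrite ra.
Qed.

Lemma performs_set_regs i ns m m' : (i + size ns <= 6)%N ->
    performs (set_regs i ns) m m' ->
  [/\ forall j, (j < size ns)%N -> ireg m' (index_reg (i + j)) = nth 0%N ns j,
      forall j, (j < i)%N -> ireg m' (index_reg j) = ireg m (index_reg j) &
      rarr m' = rarr m].
Proof.
elim: ns i m => [|n ns IH] i m; first by move=> _ ->.
rewrite [size _]/= => lti; have -> : set_regs i (n :: ns) = set_reg i n ++ set_regs i.+1 ns by [].
move=> /performs_cat[m1 /performs_set_reg h /IH].
have [|ri rj ra] := h; first by apply: leq_trans lti; rewrite addnS ltnS leq_addr.
rewrite addSnnS => /(_ lti)[ri' rj' ra']; split=> [[|j] ltj|j ji|] /=.
- by rewrite addn0 rj' // ri.
- by rewrite -addSnnS ri'.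
- by rewrite rj' ?rj // ?ltn_eqF // ltnW.
by rewrite ra' ra.
Qed.

Lemma performs_instruction ns d m m' : (size ns <= 6)%N ->
    performs (set_regs 0 ns ++ [:: d]) m m' ->
  exists m1, [/\ rarr m1 = rarr m,
    forall j, (j < size ns)%N -> ireg m1 (index_reg j) = nth 0%N ns j &
    m' = act m1 (nth Skip instructions d)].
Proof.
move=> ns6 /performs_cat[m1 /(@performs_set_regs 0 _ _ _ ns6)[rj _ ra] [c /= ->]].
by exists (iupdate (iupdate m1 digit d) code c); split.
Qed.

Definition keeps k m m' : Prop :=
  (forall j, (j < k)%N -> rarr m' work [:: j] = rarr m work [:: j]) /\
  (forall y js, y \in [:: 4; 5; 6]%N -> rarr m' y js = rarr m y js).

(** The value can be brought into any work cell [k] without disturbing the work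
    cells below [k], which serve as a stack, nor the output arrays. *)
Definition computable (x : R) : Prop := forall k, exists2 ds, proper ds &
  forall m m', same_input m -> performs ds m m' ->
    rarr m' work [:: k] = x /\ keeps k m m'.

Lemma computable_binary d (op : R -> R -> R) x y :
    (0 < d < base)%N ->
    (forall m, act m (nth Skip instructions d) =
       rupdate m work [:: ireg m (index_reg 0)]
         (op (rarr m work [:: ireg m (index_reg 0)])
             (rarr m work [:: ireg m (index_reg 1)]))) ->
  computable x -> computable y -> computable (op x y).
Proof.
move=> dP dE cx cy k; have [dx px hx] := cx k; have [dy py hy] := cy k.+1.
exists (dx ++ dy ++ set_regs 0 [:: k; k.+1] ++ [:: d]).
  by rewrite 3!proper_cat px py proper_set_regs //= dP.
move=> m m' im /performs_cat[m1 /[dup]/performs_frame f1 /(hx _ _ im)[x1 [w1 a1]]].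
have im1 := same_input_frame f1 im.
move=> /performs_cat[m2 /(hy _ _ im1)[y2 [w2 a2]]] /performs_instruction[] // m3 [ra ri ->].
rewrite dE (ri 0%N isT) (ri 1%N isT) /= ra y2 w2 // x1.
split; first by rewrite eqxx.
split=> [j jk|z js zin] /=; rewrite ra.
  by rewrite eqseq_cons andbT ltn_eqF // w2 ?w1 // ltnW.
have -> : (z == work) = false by move: zin; rewrite !inE => /or3P[] /eqP->.
by rewrite a2 ?a1.
Qed.

Lemma computable_const d js x :
    (0 < d < base)%N -> (size js <= 5)%N ->
    (forall m, same_input m ->
       (forall j, (j < size js)%N -> ireg m (index_reg j.+1) = nth 0%N js j) ->
       act m (nth Skip instructions d) = rupdate m work [:: ireg m (index_reg 0)] x) ->
  computable x.
Proof.
move=> dP js5 dE k; exists (set_regs 0 (k :: js) ++ [:: d]).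
  by rewrite proper_cat proper_set_regs //= dP.
move=> m m' im /performs_instruction[] // m1 [ra ri ->].
rewrite dE; first 1 last.
- by move=> y ks y4; rewrite ra im.
- by move=> j ltj; rewrite ri.
rewrite (ri 0%N isT) /=; split; first by rewrite eqxx.
split=> [j jk|z ks zin] /=; rewrite ra; first by rewrite eqseq_cons andbT ltn_eqF.
by have -> : (z == work) = false by move: zin; rewrite !inE => /or3P[] /eqP->.
Qed.

Lemma computable1 : computable 1.
Proof. exact: (@computable_const 13 [::]). Qed.

Lemma computable_input y js :
  (y < 4)%N -> size js = nth 0%N [:: 1; 3; 5; 4]%N y -> computable (rarr m0 y js).
Proof.
move=> y4 szjs; apply: (@computable_const (16 + y) js).
- by case: y y4 szjs => [|[|[|[|]]]].
- by rewrite szjs; case: y y4 szjs => [|[|[|[|]]]].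
move=> m im ri.
have -> : js = [seq ireg m (index_reg j.+1) | j <- iota 0 (size js)].
  apply: (@eq_from_nth _ 0%N); first by rewrite size_map size_iota.
  by move=> j ltj; rewrite (nth_map 0%N) ?size_iota // nth_iota // ri.
rewrite -im // szjs; by case: y y4 szjs => [|[|[|[|]]]].
Qed.

Definition computables : {pred R} := fun x => `[< computable x >].

(** The operations 1, subtraction and division suffice for a subfield. *)
Lemma computables_divring : divring_closed computables.
Proof.
split; first exact/asboolP/computable1.
  move=> x y /asboolP cx /asboolP cy; apply/asboolP.
  exact: (@computable_binary 14 (fun x y => x - y)).
move=> x y /asboolP cx /asboolP cy; apply/asboolP.
exact: (@computable_binary 15 (fun x y => x / y)).
Qed.

HB.instance Definition _ :=
  GRing.isDivringClosed.Build R computables computables_divring.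

Lemma act_store m y : y \in [:: 4; 5; 6]%N ->
  act m (nth Skip instructions (16 + y)) =
  rupdate m y [:: ireg m (index_reg 1); ireg m (index_reg 2); ireg m (index_reg 3)]
    (rarr m work [:: ireg m (index_reg 0)]).
Proof. by rewrite !inE => /or3P[] /eqP->. Qed.

(** Cells that receive their values later do not disturb the earlier ones, as
    [val] prescribes one value per cell. *)
Lemma performs_stores (cs : seq (nat * seq nat)) (val : nat -> seq nat -> R) :
    (forall c, c \in cs -> c.1 \in [:: 4; 5; 6]%N /\ size c.2 = 3) ->
    (forall c, c \in cs -> computable (val c.1 c.2)) ->
  exists2 ds, proper ds & forall m m', same_input m -> performs ds m m' ->
    forall c, c \in cs -> rarr m' c.1 c.2 = val c.1 c.2.
Proof.
elim: cs => [|[y js] cs IH] csP csC; first by exists [::].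
have [c cin|c cin|ds dsP dsE] := IH; try by [apply: csP; rewrite inE cin orbT|apply: csC; rewrite inE cin orbT].
have [yin szjs] := csP (y, js) (mem_head _ _); rewrite /= in yin szjs.
have [dx dxP dxE] := csC (y, js) (mem_head _ _) 0%N; rewrite /= in dxE.
exists (ds ++ dx ++ set_regs 0 (0%N :: js) ++ [:: 16 + y]%N).
  rewrite 3!proper_cat dsP dxP proper_set_regs /= ?szjs //.
  by move: yin; rewrite !inE => /or3P[] /eqP->.
move=> m m' im /performs_cat[m1 /[dup]/performs_frame f1 /(dsE _ _ im) st1].
have im1 := same_input_frame f1 im.
move=> /performs_cat[m2 /(dxE _ _ im1)[x2 [_ a2]]] /performs_instruction[|m3 [ra ri ->]].
  by rewrite /= szjs.
have jsE : js = [:: ireg m3 (index_reg 1); ireg m3 (index_reg 2); ireg m3 (index_reg 3)].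
  have := (ri 1%N, ri 2%N, ri 3%N); case: js szjs {csP csC ri dxE x2} => [|j1 [|j2 [|j3 []]]] //= _.
  by move=> [[-> // -> //] -> //].
rewrite act_store // -jsE (ri 0%N isT : ireg m3 (index_reg 0) = 0%N).
move=> [z ks] zin /=; case: ifP => [/andP[/eqP-> /eqP->]|neq]; first by rewrite ra.
move: zin; rewrite inE xpair_eqE neq /= => zin.
have [|z456 _] := csP (z, ks); first by rewrite inE zin orbT.
by rewrite ra a2 // (st1 (z, ks)).
Qed.
End Reach.

(** * Exhaustive search *)

Definition clear (xs : seq nat) : prog :=
  foldr (fun x => Seq (ISet x (IConst 0))) Skip xs.

(** The next number is decoded as a straight-line program, executed, and the
    memory that results is checked. *)
Definition attempt (f : form) : prog :=
  Seq (ISet code (IReg counter))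
    (Seq (ISet counter (IAdd (IReg counter) (IConst 1)))
      (Seq decode
        (Seq (ISet flag (IConst 1))
          (Seq (RSet acc [::] RZero) (check_form 0 f))))).

Definition search (f : form) : prog :=
  Seq (clear ([:: counter; flag] ++ map bound_reg (iota 0 max_depth)))
    (While (BIle (IReg flag) (IConst 0)) (attempt f)).

Section Search.
Variables (R : realType) (m0 : memory R) (f : form).
Implicit Types m : memory R.

Definition ready m : Prop :=
  [/\ same_input m0 m, forall x, (x < 3)%N -> ireg m x = ireg m0 x & unbound 0 m].

Lemma ready_frame m m' : frame m m' -> ready m -> ready m'.
Proof.
move=> fr [im sm um]; split; first exact: same_input_frame im.
  by case: fr => fi _ x x3; rewrite fi ?sm //; case: x x3 => [|[|[|]]].
case: fr => fi _ k kD; rewrite fi ?um //.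
Qed.

Lemma ready_iupdate m x i : x \in [:: counter; flag] -> ready m -> ready (iupdate m x i).
Proof.
move=> xin [im sm um]; split=> // [y y3|k kD] /=.
  by rewrite ltn_eqF ?sm //; move: xin; rewrite !inE => /orP[] /eqP->; rewrite (leq_trans y3).
by rewrite gtn_eqF ?um //; move: xin; rewrite !inE => /orP[] /eqP->.
Qed.

Lemma ready_scratch m c v : ready m -> ready (scratch m c v).
Proof.
move=> rm; have [] : ready (iupdate m flag c) by apply: ready_iupdate.
move=> im sm um; split=> // y js y4; rewrite -im //=.
by case: eqP y4 => // ->.
Qed.

Lemma runs_clear m xs : exists m', [/\ runs (clear xs) m m',
  forall x, ireg m' x = if x \in xs then 0%N else ireg m x & rarr m' = rarr m].
Proof.
elim: xs m => [|x xs IH] m /=; first by exists m; split=> //; apply: runs_skip.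
have [m' [rm' im' am']] := IH (iupdate m x 0); exists m'; split=> [|y|] //.
  exact: runs_seq (runs_iset m x (IConst 0)) rm'.
by rewrite im' inE /=; case: eqP => //; case: ifP.
Qed.

Hypothesis f_clean : fclean 0 f.

Lemma runs_attempt m : ready m -> exists ds m1 m2,
  [/\ runs (attempt f) m m2, ready m1 & m2 = scratch m1 (feval 0 m1 f) 0] /\
  [/\ ireg m2 counter = (ireg m counter).+1,
      forall ds0, proper ds0 -> encode ds0 = ireg m counter -> ds = ds0 &
      exists2 m', ready m' & performs ds m' m1].
Proof.
move=> rm; pose m' := iupdate (iupdate m code (ireg m counter)) counter (ireg m counter).+1.
have rm' : ready m'.
  by apply: ready_iupdate => //; apply: ready_frame rm; apply: frame_iupdate.
have [ds [m1 [run_ds perf uniq]]] := runs_decode m'.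
have rm1 : ready m1 by apply: ready_frame rm'; apply: performs_frame perf.
have um1 : unbound 0 m1 by case: rm1.
exists ds, m1, (scratch m1 (feval 0 m1 f) 0); split; split=> //.
- apply: runs_seq (runs_iset _ _ _) _; apply: runs_seq (runs_iset _ _ _) _.
  rewrite /= -/counter addn1; apply: runs_seq run_ds _.
  apply: runs_seq (runs_iset _ _ _) _; apply: runs_seq (runs_rset _ _ _ _) _.
  exact: (runs_check_form true f_clean um1).
- by case: (performs_frame perf) => fi _; rewrite /= fi.
by exists m'.
Qed.

(** The search stops at the code of [ds] at the latest.  It may stop earlier, at
    another program whose result passes the check; what is left in memory when it
    stops satisfies [f] in either case.  [m1] is the memory before the last check,
    which spoils only the flag and the array [acc]. *)
Lemma search_terminates ds : proper ds ->
    (forall m m', ready m -> performs ds m m' -> holds 0 m' f) ->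
  exists m1 m2, [/\ runs (search f) m0 m2, ready m1, holds 0 m1 f &
    forall y js, (y < acc)%N -> rarr m2 y js = rarr m1 y js].
Proof.
move=> dsP ds_ok.
have [m [run_m im am]] := runs_clear m0 ([:: counter; flag] ++ map bound_reg (iota 0 max_depth)).
have rm : ready m.
  split=> [y js _|x x3|k /andP[_ kD]]; first by rewrite am.
    by rewrite im; case: x x3 => [|[|[|]]].
  by rewrite im mem_cat map_f ?orbT // mem_iota.
suff loop n m' : ready m' -> ireg m' flag = 0%N -> (ireg m' counter + n)%N = encode ds ->
    exists m1 m2, [/\ runs (While (BIle (IReg flag) (IConst 0)) (attempt f)) m' m2,
      ready m1, holds 0 m1 f & forall y js, (y < acc)%N -> rarr m2 y js = rarr m1 y js].
  have [||m1 [m2 [run2 rm1 h1 a1]]] := loop (encode ds) m rm; rewrite ?im //.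
  by exists m1, m2; split=> //; apply: runs_seq run_m run2.
elim: n m' => [|n IH] m' rm' flag0 cE;
  have [ds' [m1 [m2 [[run2 rm1 m2E] [c2 uniq [m3 rm3 perf]]]]]] := runs_attempt rm';
  have tb : beval m' (BIle (IReg flag) (IConst 0)) by rewrite /= flag0.
  have b1 : feval 0 m1 f.
    by apply/fevalP; apply: ds_ok rm3 _; rewrite -(uniq ds) // -cE addn0.
  exists m1, m2; split=> //; last 2 first.
  - exact/fevalP.
  - by move=> y js y7; rewrite m2E /= ltn_eqF.
  by apply: runs_while_true tb run2 _; apply: runs_while_false; rewrite m2E /= b1.
case b1 : (feval 0 m1 f).
  exists m1, m2; split=> //; last 2 first.
  - by apply/fevalP; rewrite b1.
  - by move=> y js y7; rewrite m2E /= ltn_eqF.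
  by apply: runs_while_true tb run2 _; apply: runs_while_false; rewrite m2E /= b1.
have [||| m4 [m5 [run5 rm4 h4 a4]]] := IH m2.
- by rewrite m2E; apply: ready_scratch.
- by rewrite m2E b1.
- by rewrite c2 addSnnS.
by exists m4, m5; split=> //; apply: runs_while_true tb run2 run5.
Qed.
End Search.

(** * The equilibrium conditions as a formula *)

Definition bv d := IReg (bound_reg d).
Definition isucc e := IAdd e (IConst 1).

(** The arrays 4, 5 and 6 hold the policy, the flow and the value function.  The
    third index of array 6 is always 0, so that all three have the same shape. *)
Definition pi_cell t s a := RCell 4 [:: t; s; a].
Definition flow_cell t s a := RCell 5 [:: t; s; a].
Definition value_cell t s := RCell 6 [:: t; s; IConst 0].
Definition neg e := TBase (RSub RZero e).
Definition all_states := FAll 0 0.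
Definition all_actions := FAll 1 0.
Definition all_times := FAll 2 1.
Definition all_steps := FAll 2 0.
Definition nonneg := FSign false.
Definition zero := FSign true.

Definition policy_form : form :=
  all_times (all_states (FAnd
    (all_actions (nonneg (TBase (pi_cell (bv 0) (bv 1) (bv 2)))))
    (zero (TAdd (neg ROne) (TSum 1 0 (TBase (pi_cell (bv 0) (bv 1) (bv 2)))))))).

Definition initial_form : form :=
  all_states (all_actions (zero (TAdd
    (TBase (flow_cell (IConst 0) (bv 0) (bv 1)))
    (neg (RMul (pi_cell (IConst 0) (bv 0) (bv 1)) (RCell 0 [:: bv 0])))))).

Definition evolution_form : form :=
  all_steps (all_states (all_actions (zero (TAdd
    (TBase (flow_cell (isucc (bv 0)) (bv 1) (bv 2)))
    (TSum 0 0 (TSum 1 0 (neg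
      (RMul (pi_cell (isucc (bv 0)) (bv 1) (bv 2))
        (RMul (flow_cell (bv 0) (bv 3) (bv 4))
          (RCell 3 [:: bv 1; bv 3; bv 4; bv 0])))))))))).

(** The Bellman gap at time [bv 0], state [bv 1] and action [bv 2]. *)
Definition gap_term : term :=
  TAdd (TBase (RSub (value_cell (bv 0) (bv 1)) (RCell 1 [:: bv 1; bv 2; bv 0])))
    (TAdd
      (TSum 0 0 (TSum 1 0 (neg
        (RMul (flow_cell (bv 0) (bv 3) (bv 4))
          (RCell 2 [:: bv 1; bv 2; bv 0; bv 3; bv 4])))))
      (TSum 0 0 (neg
        (RMul (RCell 3 [:: bv 3; bv 1; bv 2; bv 0]) (value_cell (isucc (bv 0)) (bv 3)))))).

Definition optimality_form : form :=
  all_times (all_states (all_actions (FAnd (nonneg gap_term)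
    (FGuard (BNot (BRle (flow_cell (bv 0) (bv 1) (bv 2)) RZero)) (zero gap_term))))).

Definition terminal_form : form :=
  all_states (zero (TBase (value_cell (isucc (IReg 2)) (bv 0)))).

Definition nash_form : form :=
  FAnd policy_form (FAnd initial_form (FAnd evolution_form
    (FAnd optimality_form terminal_form))).

Lemma rk_lt (X : finType) (x : X) : (rk x < #|X|)%N.
Proof. exact: ltn_ord. Qed.

Lemma rk_surj (X : finType) i : (i < #|X|)%N -> exists x : X, i = rk x.
Proof. by move=> lti; exists (enum_val (Ordinal lti)); rewrite /rk enum_valK. Qed.

Lemma sum_rk (V : nmodType) (X : finType) (F : nat -> V) :
  \sum_(i < #|X|) F i = \sum_(x : X) F (rk x).
Proof.
rewrite [RHS](reindex _ (onW_bij _ (enum_val_bij X))) /=.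
by apply: eq_bigr => i _; rewrite /rk enum_valK.
Qed.

Section NashForm.
Variables (R : realType) (S A : finType) (T : nat) (mu0 : dist R S).
Variables (rbar : S -> A -> 'I_T.+1 -> R) (Rbar : S -> A -> 'I_T.+1 -> S * A -> R).
Variable Pbar : S -> S -> A -> 'I_T.+1 -> R.
Variable m : memory R.

Definition policy_table t (s : S) (a : A) : R := rarr m 4 [:: t; rk s; rk a].
Definition flow_table t (x : S * A) : R := rarr m 5 [:: t; rk x.1; rk x.2].
Definition value_table t (s : S) : R := rarr m 6 [:: t; rk s; 0%N].

Local Notation p := policy_table.
Local Notation l := flow_table.
Local Notation v := value_table.

Hypothesis input : holds_input mu0 rbar Rbar Pbar m.

Lemma holds_nash : holds 0 m nash_form <->
  certificate T mu0 (trans_at Pbar) (rbar_at rbar) (Rbar_at Rbar)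
    policy_table flow_table value_table.
Proof.
case: input => -[rS rA rT] mu0E rE RE PE.
have PE' t s a s' : (t <= T)%N ->
    rarr m 3 [:: rk s'; rk s; rk a; t] = trans_at Pbar t s a s'.
  by move=> tT; rewrite /trans_at -PE /= inordK.
have policyE t s : 0 - 1 + \sum_(i < #|A|) rarr m 4 [:: t; rk s; i : nat] =
    \sum_a p t s a - 1.
  by rewrite (sum_rk _ (fun i => rarr m 4 [:: t; rk s; i])) sub0r addrC.
have evolutionE t s' a' : (t < T)%N ->
    rarr m 5 [:: (t + 1)%N; rk s'; rk a'] + \sum_(i < #|S|) \sum_(j < #|A|)
      (0 - rarr m 4 [:: (t + 1)%N; rk s'; rk a'] *
        (rarr m 5 [:: t; i : nat; j : nat] * rarr m 3 [:: rk s'; i : nat; j : nat; t])) =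
    l t.+1 (s', a') - p t.+1 s' a' * state_law mu0 (trans_at Pbar) l t.+1 s'.
  move=> tT; rewrite addn1; congr (_ + _).
  rewrite (sum_rk _ (fun i => \sum_(j < #|A|) (0 - _ * (rarr m 5 [:: t; i; j : nat] * rarr m 3 [:: rk s'; i; j : nat; t])))).
  rewrite /= mulr_sumr -sumrN; apply: eq_bigr => s _.
  rewrite (sum_rk _ (fun j => 0 - _ * (rarr m 5 [:: t; rk s; j] * rarr m 3 [:: rk s'; rk s; j; t]))).
  rewrite mulr_sumr -sumrN; apply: eq_bigr => a _.
  by rewrite PE' 1?ltnW // sub0r.
have gapE t s a : (t <= T)%N ->
    rarr m 6 [:: t; rk s; 0%N] - rarr m 1 [:: rk s; rk a; t] +
      (\sum_(i < #|S|) \sum_(j < #|A|)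
        (0 - rarr m 5 [:: t; i : nat; j : nat] * rarr m 2 [:: rk s; rk a; t; i : nat; j : nat]) +
      \sum_(i < #|S|)
        (0 - rarr m 3 [:: i : nat; rk s; rk a; t] * rarr m 6 [:: (t + 1)%N; i : nat; 0%N])) =
    v t s - qval (trans_at Pbar) (mf_reward (rbar_at rbar) (Rbar_at Rbar) l) v t s a.
  move=> tT; rewrite /qval /mf_reward !opprD !addrA; congr (_ - _ + _ + _).
  - by rewrite /rbar_at -rE /= inordK.
  - rewrite (sum_rk _ (fun i => \sum_(j < #|A|) (0 - rarr m 5 [:: t; i; j : nat] * rarr m 2 [:: rk s; rk a; t; i; j : nat]))).
    rewrite big_pair -sumrN; apply: eq_bigr => s' _.
    rewrite (sum_rk _ (fun j => 0 - rarr m 5 [:: t; rk s'; j] * rarr m 2 [:: rk s; rk a; t; rk s'; j])).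
    rewrite -sumrN; apply: eq_bigr => a' _.
    by rewrite /Rbar_at -RE /= inordK // sub0r.
  rewrite (sum_rk _ (fun i => 0 - rarr m 3 [:: i; rk s; rk a; t] * rarr m 6 [:: (t + 1)%N; i; 0%N])).
  by rewrite -sumrN; apply: eq_bigr => s' _; rewrite PE' // sub0r addn1.
rewrite /= rS rA rT !addn0 addn1; split.
  move=> [h_pol [h_init [h_evol [h_opt h_end]]]]; split.
  - by move=> t s a tT; have [h _] := h_pol t tT _ (rk_lt s); apply: h (rk_lt a).
  - move=> t s tT; have [_ /eqP] := h_pol t tT _ (rk_lt s).
    by rewrite policyE subr_eq0 => /eqP.
  - case=> [|t] tT s a; apply/eqP; rewrite -subr_eq0; last first.
      by rewrite -evolutionE // h_evol ?rk_lt.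
    by rewrite /= -mu0E -sub0r h_init ?rk_lt.
  - move=> t s a tT; have [] := h_opt t tT _ (rk_lt s) _ (rk_lt a).
    rewrite gapE // subr_ge0 -ltNge => ge eq; split=> // /eq/eqP.
    by rewrite subr_eq0 => /eqP->.
  by move=> s; apply: h_end (rk_lt s).
case=> p_ge0 p1 lE v_opt v_end; split; last split; last split; last split.
- move=> t tT _ /(@rk_surj S)[s ->]; rewrite policyE p1 // subrr; split=> //.
  by move=> _ /(@rk_surj A)[a ->]; apply: p_ge0.
- move=> _ /(@rk_surj S)[s ->] _ /(@rk_surj A)[a ->].
  by rewrite mu0E sub0r; apply/eqP; rewrite subr_eq0; apply/eqP; apply: (lE 0%N).
- move=> t tT _ /(@rk_surj S)[s ->] _ /(@rk_surj A)[a ->].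
  by rewrite evolutionE // lE // subrr.
- move=> t tT _ /(@rk_surj S)[s ->] _ /(@rk_surj A)[a ->].
  have [ge le] := v_opt t s a tT.
  rewrite gapE // subr_ge0 ge -ltNge; split=> // /le le'.
  by apply/eqP; rewrite subr_eq0 eq_le le' ge.
by move=> _ /(@rk_surj S)[s ->]; apply: v_end.
Qed.
End NashForm.

Local Close Scope ring_scope.

Theorem proposition12 (R : realType) :
  exists p : prog,
    forall (S A : finType) (T : nat) (G : mfg R S A T)
           (rbar : S -> A -> 'I_T.+1 -> R)
           (Rbar : S -> A -> 'I_T.+1 -> S * A -> R)
           (Pbar : S -> S -> A -> 'I_T.+1 -> R),
      0 < #|A| ->
      linear_rewards G rbar Rbar ->
      mean_field_independent G Pbar ->
      forall m : memory R,
        holds_input (init G) rbar Rbar Pbar m ->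
        exists m' : memory R,
          terminates_with p m m' /\
          exists (pi : policy R S A T) (L : flow R S A T),
            holds_output pi L m' /\ nash_equilibrium G pi L.
Proof.
exists (search nash_form) => S A T G rbar Rbar Pbar A_gt0 rewardE transE m0 input.
have ready_input m : ready m0 m -> holds_input (init G) rbar Rbar Pbar m.
  case: input => -[rS rA rT] mu0E rE RE PE [im sm _].
  split; first (by rewrite !sm); by move=> *; rewrite im ?mu0E ?rE ?RE ?PE.
have [a0 _] : exists a : A, a \in A by apply/card_gt0P.
have [mu0E rE RE PE] :
  [/\ forall s, init G s \in computables m0,
      forall t s a, rbar_at rbar t s a \in computables m0,
      forall t s a x, Rbar_at Rbar t s a x \in computables m0 &
      forall t s a s', trans_at Pbar t s a s' \in computables m0].
  case: input => _ mu0E rE RE PE; split=> [s|t s a|t s a [s' a']|t s a s'].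
  - by rewrite -mu0E; apply/asboolP; apply: computable_input.
  - by rewrite /rbar_at -rE; apply/asboolP; apply: computable_input.
  - by rewrite /Rbar_at -RE; apply/asboolP; apply: computable_input.
  by rewrite /trans_at -PE; apply/asboolP; apply: computable_input.
have [p [l [v [cert pK lK vK]]]] := certificate_exists T (dist_ge0 (init G))
  (trans_at_ge0 transE A_gt0) a0 mu0E PE rE RE.
have [s0 _] : exists s : S, True.
  apply: contrapT => none; have := dist_sum1 (init G); rewrite big_pred0.
    by move/eqP; rewrite eq_sym oner_eq0.
  by move=> s; case: none; exists s.
pose val y (js : seq nat) : R :=
  let t := nth 0%N js 0 in let s := nth s0 (enum S) (nth 0%N js 1) in
  let a := nth a0 (enum A) (nth 0%N js 2) in
  if y == 4%N then p t s a else if y == 5%N then l t (s, a) else v t s.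
(* Finitely many cells matter: times up to [T.+1], where the value is 0. *)
pose cells_at (t : nat) (s : S) (a : A) : seq (nat * seq nat) :=
  [:: (4, [:: t; rk s; rk a]); (5, [:: t; rk s; rk a]); (6, [:: t; rk s; 0])]%N.
pose cells := flatten [seq cells_at z.1.1 z.1.2 z.2 | z : 'I_T.+2 * S * A].
have cellP t s a c : (t <= T.+1)%N -> c \in cells_at t s a -> c \in cells.
  move=> tT cin; apply/flattenP; exists (cells_at t s a) => //.
  by apply/mapP; exists (inord t, s, a); rewrite ?mem_enum //= inordK.
have [c /flattenP[_ /mapP[[[t s] a] _ ->]]|c _|ds ds_proper stored] :=
    @performs_stores _ m0 cells val.
- by rewrite !inE => /or3P[] /eqP->.
- rewrite /val; case: ifP => _; first exact/asboolP/pK.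
  by case: ifP => _; [exact/asboolP/lK|exact/asboolP/vK].
have [m m' rm perf|m1 [m2 [run2 rm1 h1 a1]]] := @search_terminates _ m0 nash_form isT ds ds_proper.
  have im' : holds_input (init G) rbar Rbar Pbar m'.
    by apply: ready_input; apply: ready_frame rm; apply: performs_frame perf.
  have {}stored := stored _ _ (let: And3 im _ _ := rm in im) perf.
  apply/(holds_nash im'); apply: certificate_ext cert.
  - move=> t s a tT; rewrite /policy_table (stored (4, _)%N); last first.
      by rewrite (@cellP t s a) ?leqW // mem_head.
    by rewrite /val /= !nth_enum_rank.
  - move=> t [s a] tT; rewrite /flow_table (stored (5, _)%N); last first.
      by rewrite (@cellP t s a) ?leqW // !inE eqxx.
    by rewrite /val /= !nth_enum_rank.
  move=> t s tT; rewrite /value_table (stored (6, _)%N); last first.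
    by rewrite (@cellP t s a0) // !inE eqxx.
  by rewrite /val /= nth_enum_rank.
have [pi [L [piE LE nash]]] := certificate_sound rewardE transE A_gt0
  ((holds_nash (ready_input _ rm1)).1 h1).
exists m2; split; first exact: runs_terminates.
by exists pi, L; split=> //; split=> t s a; rewrite a1 // ?piE ?LE.
Qed.
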